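(* For every $\varepsilon\in[0,\varepsilon_0]$ let $p_\varepsilon,Q_\varepsilon$ be measurable complex-valued functions on the finite interval $\mathcal J=(a,b)$ with $1/p_\varepsilon,\ Q_\varepsilon/p_\varepsilon,\ Q_\varepsilon^2/p_\varepsilon\in L_1(\mathcal J,\mathbb C)$, let $\alpha(\varepsilon),\beta(\varepsilon)\in\mathbb C^{2\times2}$, and let $L_\varepsilon$ be the operator on $L_2(\mathcal J,\mathbb C)$ generated by the quasi-differential expression $l_\varepsilon[y]=-D^{[2]}_\varepsilon y$ and the two-point boundary condition $\alpha(\varepsilon)\mathcal Y_\varepsilon(a)+\beta(\varepsilon)\mathcal Y_\varepsilon(b)=0$ (as defined in the context). Suppose that the resolvent set $\rho(L_0)$ is not empty and that, as $\varepsilon\to0+$, (1) $\|1/p_\varepsilon-1/p_0\|_1\to0$, (2) $\|Q_\varepsilon/p_\varepsilon-Q_0/p_0\|_1\to0$, (3) $\|Q_\varepsilon^2/p_\varepsilon-Q_0^2/p_0\|_1\to0$, (4) $\alpha(\varepsilon)\to\alpha(0)$ and $\beta(\varepsilon)\to\beta(0)$, where $\|\cdot\|_1$ is the norm of $L_1(\mathcal J,\mathbb C)$. Then $L_\varepsilon$ converges to $L_0$ as $\varepsilon\to0+$ in the sense of norm resolvent convergence.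
   Context: Let $\mathcal J=(a,b)$ be a finite interval, $L_2=L_2(\mathcal J,\mathbb C)$, and $\varepsilon_0>0$. For each $\varepsilon\in[0,\varepsilon_0]$ the functions $p_\varepsilon$ (finite and nonzero a.e.) and $Q_\varepsilon$ are the coefficients of the formal Sturm-Liouville expression $-(p_\varepsilon y')'+q_\varepsilon y$ with $q_\varepsilon=Q_\varepsilon'$ (distributional derivative), which is interpreted through the quasi-derivatives $$D^{[0]}_\varepsilon y=y,\qquad D^{[1]}_\varepsilon y=p_\varepsilon y'-Q_\varepsilon y,\qquad D^{[2]}_\varepsilon y=(D^{[1]}_\varepsilon y)'+\frac{Q_\varepsilon}{p_\varepsilon}D^{[1]}_\varepsilon y+\frac{Q_\varepsilon^2}{p_\varepsilon}y,$$ as $l_\varepsilon[y]:=-D^{[2]}_\varepsilon y$. The maximal operator is $L^\varepsilon_{\max}y=l_\varepsilon[y]$ with $$\operatorname{Dom}(L^\varepsilon_{\max})=\{y\in L_2:\ y,\ D^{[1]}_\varepsilon y\in AC([a,b],\mathbb C),\ D^{[2]}_\varepsilon y\in L_2\}.$$ Put $\mathcal Y_\varepsilon(a)=(y(a),D^{[1]}_\varepsilon y(a))$, $\mathcal Y_\varepsilon(b)=(y(b),D^{[1]}_\varepsilon y(b))\in\mathbb C^2$. The operator $L_\varepsilon$ is defined by $$L_\varepsilon y=l_\varepsilon[y],\qquad \operatorname{Dom}(L_\varepsilon)=\{y\in\operatorname{Dom}(L^\varepsilon_{\max}):\ \alpha(\varepsilon)\mathcal Y_\varepsilon(a)+\beta(\varepsilon)\mathcal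 Y_\varepsilon(b)=0\}.$$ Norm resolvent convergence of $L_\varepsilon$ to $L_0$ means: there is $\mu\in\mathbb C$ with $\mu\in\rho(L_0)$ and $\mu\in\rho(L_\varepsilon)$ for all sufficiently small $\varepsilon$, and $\|(L_\varepsilon-\mu)^{-1}-(L_0-\mu)^{-1}\|\to0$ as $\varepsilon\to0+$ (operator norm on $L_2$). *)

(* Defs.v *)
From HB Require Import structures.
From mathcomp Require Import all_boot all_order all_algebra.
From mathcomp Require Import all_classical all_reals all_analysis.
From mathcomp Require Export complex.

Set Implicit Arguments.
Unset Strict Implicit.
Unset Printing Implicit Defensive.

Import Order.TTheory GRing.Theory Num.Theory.
Import numFieldNormedType.Exports.

Local Open Scope classical_set_scope.
Local Open Scope ring_scope.

(* Throughout, J = ]a, b[.  Functions on J are represented by total functions *)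
(* R -> R[i]; an element of L_p(J, C) is represented by any of its            *)
(* representatives, equality in L_p being equality almost everywhere on J.    *)

Section FunctionSpaces.
Context {R : realType} (a b : R).

Definition aeJ (P : R -> Prop) : Prop :=
  {ae (@lebesgue_measure R), forall t, `]a, b[%classic t -> P t}.

(* Measurability is with respect to the Borel sets.  Every Lebesgue           *)
(* measurable function agrees almost everywhere with a Borel one, and all     *)
(* the notions below only depend on almost everywhere classes.                *)
Definition measurableJ (f : R -> R[i]) : Prop :=
  measurable_fun `]a, b[ (fun t => complex.Re (f t)) /\
  measurable_fun `]a, b[ (fun t => complex.Im (f t)).

Definition normLp (p : R) (f : R -> R[i]) : \bar R :=
  Lnorm (@lebesgue_measure R) p%:E
    ((fun t => (Normc.normc (f t))%:E) \_ `]a, b[).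

Definition inLp (p : R) (f : R -> R[i]) : Prop :=
  measurableJ f /\ (normLp p f < +oo)%E.

Definition absolutely_continuous (f : R -> R[i]) : Prop :=
  forall e : R, 0 < e -> exists2 d : R, 0 < d &
    forall (n : nat) (s t : 'I_n -> R),
      (forall i, [/\ a <= s i, s i < t i & t i <= b]) ->
      trivIset setT (fun i => `]s i, t i[%classic) ->
      \sum_(i < n) (t i - s i) < d ->
      \sum_(i < n) Normc.normc (f (t i) - f (s i)) < e.

Definition has_deriv (f : R -> R[i]) (t : R) (w : R[i]) : Prop :=
  is_derive t 1 (fun s => complex.Re (f s)) (complex.Re w) /\
  is_derive t 1 (fun s => complex.Im (f s)) (complex.Im w).

End FunctionSpaces.

Section OperatorsL2.
Context {R : realType} (a b : R).

(* A (possibly unbounded, partially defined) operator in L_2(J, C) is given   *)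
(* by its graph: [A y f] means that y is in the domain of A and A y = f.      *)
Definition operatorL2 := (R -> R[i]) -> (R -> R[i]) -> Prop.

(* The graph of (A - mu)^-1. *)
Definition resolvent (A : operatorL2) (mu : R[i]) : operatorL2 :=
  fun f y => exists2 g, A y g & aeJ a b (fun t => f t = g t - mu * y t).

Definition in_resolvent_set (A : operatorL2) (mu : R[i]) : Prop :=
  [/\ forall f, inLp a b 2 f -> exists y, resolvent A mu f y,
      forall f y z, inLp a b 2 f ->
        resolvent A mu f y -> resolvent A mu f z ->
        aeJ a b (fun t => y t = z t)
    & exists M : R, forall f y, inLp a b 2 f -> resolvent A mu f y ->
        (normLp a b 2 y <= M%:E * normLp a b 2 f)%E].

Definition sub_operator (S T : operatorL2) : operatorL2 :=
  fun f z => exists g h, [/\ S f g, T f h & aeJ a b (fun t => z t = g t - h t)].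

Definition opnorm (T : operatorL2) : \bar R :=
  ereal_sup [set r | exists f z, [/\ inLp a b 2 f, (normLp a b 2 f <= 1)%E,
    inLp a b 2 z, T f z & r = normLp a b 2 z]].

Definition norm_resolvent_cvg (L : R -> operatorL2) : Prop :=
  exists mu : R[i],
    [/\ in_resolvent_set (L 0) mu,
        \forall eps \near 0^'+, in_resolvent_set (L eps) mu
      & opnorm (sub_operator (resolvent (L eps) mu) (resolvent (L 0) mu))
          @[eps --> 0^'+] --> 0%E].

End OperatorsL2.

Section SturmLiouville.
Context {R : realType} (a b : R).

(* y1 = D^[1] y almost everywhere. *)
Definition quasi_deriv1 (p Q y y1 : R -> R[i]) : Prop :=
  aeJ a b (fun t => exists2 dy, has_deriv y t dy &
    y1 t = p t * dy - Q t * y t).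

(* y2 = D^[2] y almost everywhere, where y1 = D^[1] y. *)
Definition quasi_deriv2 (p Q y y1 y2 : R -> R[i]) : Prop :=
  aeJ a b (fun t => exists2 dy1, has_deriv y1 t dy1 &
    y2 t = dy1 + Q t / p t * y1 t + Q t ^+ 2 / p t * y t).

(* y is in the domain of the maximal operator, with quasi-derivatives y1 and  *)
(* y2.  The function D^[1] y is only defined almost everywhere by y; as it is *)
(* required to be absolutely continuous, y1 is its continuous representative  *)
(* on [a, b], which is unique and gives the boundary values.                  *)
Definition maximal_domain (p Q y y1 y2 : R -> R[i]) : Prop :=
  [/\ inLp a b 2 y,
      absolutely_continuous a b y /\ absolutely_continuous a b y1,
      quasi_deriv1 p Q y y1, quasi_deriv2 p Q y y1 y2
    & inLp a b 2 y2].

Definition boundary_vector (y y1 : R -> R[i]) (x : R) : 'cV[R[i]]_2 :=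
  \col_i (if i == 0 then y x else y1 x).

Definition sturm_liouville (p Q : R -> R[i]) (alpha beta : 'M[R[i]]_2) :
    operatorL2 :=
  fun y f => exists y1 y2,
    [/\ maximal_domain p Q y y1 y2,
        alpha *m boundary_vector y y1 a + beta *m boundary_vector y y1 b = 0,
        inLp a b 2 f
      & aeJ a b (fun t => f t = - y2 t)].

End SturmLiouville.

(* Main.v *)
Require Import Defs.
From HB Require Import structures.
From mathcomp Require Import all_boot all_order all_algebra.
From mathcomp Require Import all_classical all_reals all_analysis.
From mathcomp Require Import measurable_realfun complex ring lra.
Import Order.TTheory GRing.Theory Num.Theory.
Import numFieldNormedType.Exports.
Set Implicit Arguments.
Unset Strict Implicit.
Unset Printing Implicit Defensive.
Local Open Scope classical_set_scope.
Local Open Scope ring_scope.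

(** For Y = (y, D^[1] y), the equation (l_eps - mu) y = f is a first-order linear
    system Y' = A_eps Y + F, and (1)-(3) say that A_eps tends to A_0 in L_1.  If
    mu belongs to rho(L_0), the homogeneous boundary value problem for A_0 has
    only the zero solution; writing Phi for the fundamental matrix, the matrix
    alpha + beta Phi(b) is then invertible, which gives for the problem with
    source F and boundary datum g a unique solution, bounded uniformly by
    K (|g| + int |F|).  A solution Y of the eps-problem solves the problem for
    A_0 with source F + (A_eps - A_0) Y and a boundary datum that is o(1) sup |Y|.
    Hence, for small eps, the eps-problem has only the zero homogeneous solution
    and satisfies the bound with 2K, so that mu belongs to rho(L_eps), and its
    solution differs from that of the limit problem by o(1) int |F|.
    The complex 2x2 system is written as a real 4x4 one, and solutions are taken
    to be bounded measurable functions on R that satisfy the integral equation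
    for coefficients cut off outside of ]a, b[. *)

(** The coefficients are controlled in L_1 only, so solutions are differentiable merely almost
    everywhere. The link between the integral equation and the definition of the operators is
    therefore that an absolutely continuous function whose derivative is 0 almost everywhere is
    constant; it is proved here by a covering argument. For the integral equation, the sup norm is
    weighted by exp(2 K), where K(t) is the integral of |A| up to t. Whatever the size of A, Y ->
    int A Y is then a contraction of factor 1/2. Existence, uniqueness and the a priori bound all
    come from this, and they ask of a solution only that it be bounded and measurable. The condition
    on mu speaks of y alone, and only almost everywhere. That the whole vector (y, D^[1] y) vanishes
    has to be recovered from y' = (Q/p) y + (1/p) D^[1] y and p != 0. On a finite interval the sup
    norm dominates the L_2 norm, which dominates the L_1 norm, up to constants. Hence sup bounds in
    terms of int |F| become operator norm bounds on L_2. *)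

(** * Absolutely continuous functions with zero derivative almost everywhere *)

Section AbsoluteContinuity.
Context {R : realType}.
Local Notation mu := (@lebesgue_measure R).

Definition real_ac (a b : R) (u : R -> R) : Prop :=
  forall e : R, 0 < e -> exists2 d : R, 0 < d &
    forall (n : nat) (s t : 'I_n -> R),
      (forall i, [/\ a <= s i, s i < t i & t i <= b]) ->
      trivIset setT (fun i => `]s i, t i[%classic) ->
      \sum_(i < n) (t i - s i) < d ->
      \sum_(i < n) `|u (t i) - u (s i)| < e.

(** One domination principle stands for the closure rules under differences, multiples and Lipschitz
    images. When a single function dominates, it is passed twice, which also provides a factor 2. *)
Lemma real_ac_le2 (a b C : R) (u v w : R -> R) : 0 <= C ->
  (forall x y, a <= x <= b -> a <= y <= b ->
    `|u x - u y| <= C * (`|v x - v y| + `|w x - w y|)) ->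
  real_ac a b v -> real_ac a b w -> real_ac a b u.
Proof.
move=> C0 uvw acv acw e e0.
have e'0 : 0 < e / (C + 1) / 2 by rewrite !divr_gt0// ltr_wpDl.
have [d1 d10 H1] := acv _ e'0; have [d2 d20 H2] := acw _ e'0.
exists (Num.min d1 d2); first by rewrite lt_min d10.
move=> n s t st tr; rewrite lt_min => /andP[/(H1 _ _ _ st tr) h1 /(H2 _ _ _ st tr) h2].
have : \sum_(i < n) `|u (t i) - u (s i)| <=
    C * (\sum_(i < n) `|v (t i) - v (s i)| + \sum_(i < n) `|w (t i) - w (s i)|).
  rewrite -big_split /= mulr_sumr; apply: ler_sum => i _.
  by have [? ? ?] := st i; apply: uvw; lra.
move=> /le_lt_trans; apply; apply: (@le_lt_trans _ _ (C * (e / (C + 1)))).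
  by apply: ler_wpM2l => //; lra.
by rewrite mulrA ltr_pdivrMr ?ltr_wpDl//; lra.
Qed.

Lemma real_acS (a b c d : R) (u : R -> R) : a <= c -> d <= b ->
  real_ac a b u -> real_ac c d u.
Proof.
move=> ac db acu e /acu[r r0 H]; exists r => // n s t st; apply: H => i.
by have [? ? ?] := st i; split => //; lra.
Qed.

(* U will be a small open set containing the exceptional null set: u has slope
   at most e near the points outside U, and the intervals collected are those
   that cover the points of U; a supremum argument carries x from a to b. *)
Let reached (a e : R) (u : R -> R) (U : set R) (x : R) : Prop :=
  exists (n : nat) (s t : 'I_n -> R),
    [/\ forall i, [/\ a <= s i, s i < t i & t i <= x],
        trivIset setT (fun i => `]s i, t i[%classic),
        ((\sum_(i < n) (t i - s i))%:E <= mu (U `&` `]a, x[))%E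
      & `|u x - u a| <= e * (x - a) + \sum_(i < n) `|u (t i) - u (s i)|].

(** A step of slope at most [e] is paid by the term [e * (y - x)]; the collection of intervals stays
    the same. *)
Let reached_slope (a e : R) u U (x y : R) : a <= x -> x < y ->
  open U -> `|u y - u x| <= e * (y - x) -> reached a e u U x -> reached a e u U y.
Proof.
move=> ax xy oU slope [n [s [t [st tr len var]]]]; exists n, s, t; split => //.
- by move=> i; have [? ? ?] := st i; split => //; lra.
- apply: (le_trans len); apply: le_measure; rewrite ?inE.
  + by apply: measurableI => //; exact: open_measurable.
  + by apply: measurableI => //; exact: open_measurable.
  + apply: setIS; apply: subset_itvl; rewrite bnd_simp; lra.
- rewrite (_ : u y - u a = (u y - u x) + (u x - u a)); last by ring.
  apply: (le_trans (ler_normD _ _)); move: slope var; lra.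
Qed.

(** A step inside [U] adds []x, y[] to the collection: its increment enters the sum, and its length
    is paid by the part of [U] between [x] and [y], which is disjoint from the part already used. *)
Let reached_open (a e : R) u (U : set R) (x y : R) : 0 <= e -> a <= x -> x < y ->
  open U -> `]x, y[ `<=` U -> reached a e u U x -> reached a e u U y.
Proof.
move=> e0 ax xy oU xyU [n [s [t [st tr len var]]]].
(* The new interval takes the last index [ord_max]. The old ones are found through [unlift], and
   [wid] matches them with the indexing of [big_ord_recr]. *)
pose s' (i : 'I_n.+1) := oapp s x (unlift ord_max i).
pose t' (i : 'I_n.+1) := oapp t y (unlift ord_max i).
have wid (i : 'I_n) : widen_ord (leqnSn n) i = lift ord_max i.
  by apply: val_inj; rewrite /= /bump leqNgt ltn_ord.
exists n.+1, s', t'; split.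
- move=> i; rewrite /s' /t'; case: unliftP => [j|] _ /=.
    by have [? ? ?] := st j; split => //; clear s' t'; lra.
  by split.
- move=> i j _ _; rewrite /s' /t'.
  case: (unliftP ord_max i) => [i'|] ei; case: (unliftP ord_max j) => [j'|] ej /=.
  + by move=> h; rewrite ei ej; congr lift; exact: tr.
  + case=> z /= []; rewrite !in_itv/= => /andP[_ zt] /andP[xz _].
    by have [_ _ tx] := st i'; have := lt_trans zt (le_lt_trans tx xz); rewrite ltxx.
  + case=> z /= []; rewrite !in_itv/= => /andP[xz _] /andP[_ zt].
    by have [_ _ tx] := st j'; have := lt_trans zt (le_lt_trans tx xz); rewrite ltxx.
  + by rewrite ei ej.
- rewrite big_ord_recr/= /s' /t' unlift_none /=.
  under eq_bigr do rewrite wid liftK /=.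
  apply: (@le_trans _ _ (mu ((U `&` `]a, x[) `|` `]x, y[))).
    rewrite measureU //.
    + rewrite EFinD leeD//.
      by rewrite -[X in (_ <= mu X)%E]/[set` `]x, y[] lebesgue_measure_itv/= lte_fin xy.
    + by apply: measurableI => //; exact: open_measurable.
    + apply/seteqP; split => // z /= [[_]]; rewrite !in_itv/= => /andP[? ?] /andP[? ?].
      clear s' t'; lra.
  apply: le_measure; rewrite ?inE.
  + apply: measurableU => //; apply: measurableI => //; exact: open_measurable.
  + by apply: measurableI => //; exact: open_measurable.
  + move=> z /= [[Uz]|zxy]; rewrite in_itv/=.
      by move=> /andP[? ?]; split => //; rewrite in_itv/=; apply/andP; split; clear s' t'; lra.
    split; first exact: xyU.
    by move: zxy; rewrite !in_itv/= => /andP[? ?]; apply/andP; split; clear s' t'; lra.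
- rewrite big_ord_recr/= /s' /t' unlift_none /=.
  under eq_bigr do rewrite wid liftK /=.
  rewrite (_ : u y - u a = (u y - u x) + (u x - u a)); last by ring.
  apply: (le_trans (ler_normD _ _)).
  have : e * (x - a) <= e * (y - a) by apply: ler_wpM2l => //; clear s' t'; lra.
  move: var; clear s' t'; lra.
Qed.

Let reached_end (a b e : R) u (U : set R) : a < b -> open U -> U a -> U b ->
  (forall t, a < t < b -> ~ U t -> is_derive t 1 u 0) -> 0 < e ->
  reached a e u U b.
Proof.
move=> ab oU Ua Ub du e0.
have ra : reached a e u U a.
  exists 0%N, (fun=> 0), (fun=> 0); split => //.
  - by case.
  - by case.
  - by rewrite big_ord0.
  - by rewrite big_ord0 !subrr normr0 mulr0 addr0.
(* The derivative at [c] compares values with [u c] only, so the steps allowed near [c] go from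
   [s <= c] to [t >= c]. The ends [a] and [b] lie in [U], hence [c] is interior when it is outside
   [U]. *)
have local (c : R) : a <= c <= b -> exists2 r : R, 0 < r & forall s t,
    a <= s -> t <= b -> c - r < s -> s <= c -> c <= t -> t < c + r -> s < t ->
    reached a e u U s -> reached a e u U t.
  move=> acb; have [Uc|nUc] := pselect (U c).
    have /nbhs_ballP[r /= r0 ball_U] : nbhs c U by exact: open_nbhs_nbhs.
    exists r => // s t a_s tb cs sc ct tc st.
    apply: (reached_open (ltW e0)) => //.
    move=> z /=; rewrite in_itv/= => /andP[? ?]; apply: ball_U.
    by rewrite /ball/= ltr_norml; apply/andP; split; lra.
  have acb' : a < c < b.
    move: acb; rewrite !le_eqVlt => /andP[/orP[/eqP ac|->] /orP[/eqP cb|->]] //.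
    - by exfalso; apply: nUc; rewrite -ac.
    - by exfalso; apply: nUc; rewrite -ac.
    - by exfalso; apply: nUc; rewrite cb.
  have [dc dc0] := du c acb' nUc.
  have : h^-1 *: ((u \o shift c) (h *: (1 : R)) - u c) @[h --> (0 : R)^'] --> (0 : R).
    have := dc; rewrite /derivable; move: dc0; rewrite /derive => -> h; exact: h.
  move=> /cvgrPdist_lt /(_ _ e0).
  rewrite near_withinE => /nbhs_ballP[r /= r0 Hr].
  have slope h : `|h| < r -> `|u (h + c) - u c| <= e * `|h|.
    move=> hr; have [->|h0] := eqVneq h 0.
      by rewrite add0r subrr normr0 mulr0.
    have := Hr h; rewrite /ball/= sub0r normrN => /(_ hr h0).
    rewrite sub0r normrN normrM normfV mulrC ltr_pdivrMr ?normr_gt0// => /ltW.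
    by rewrite [h *: 1]mulr1.
  exists r => // s t a_s tb cs sc ct tc st.
  apply: reached_slope => //.
  have := slope (s - c); have := slope (t - c); rewrite !subrK.
  rewrite (@ger0_norm _ (t - c)) ?subr_ge0// (@ler0_norm _ (s - c)) ?subr_le0// => h1 h2.
  have {}h1 : `|u t - u c| <= e * (t - c) by apply: h1; lra.
  have {}h2 : `|u s - u c| <= e * - (s - c) by apply: h2; lra.
  rewrite (_ : u t - u s = (u t - u c) - (u s - u c)); last by ring.
  apply: (le_trans (ler_normB _ _)); lra.
pose S := [set x | a <= x <= b /\ reached a e u U x].
have S_ub : ubound S b by move=> x [/andP[]].
have hS : has_sup S by split; [exists a; split; rewrite ?lexx ?ltW|exists b].
have Sa : S a by split; rewrite ?lexx ?ltW.
have acb : a <= sup S <= b.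
  by apply/andP; split; [exact: ub_le_sup hS.2 _ Sa|apply: ge_sup => //; exists a].
have [r r0 Hr] := local _ acb.
have [s [sab rs] cs] := sup_adherent r0 hS.
have sc : s <= sup S by apply: ub_le_sup => //; exact: hS.2.
(* A step from [s], just below the supremum, to [t] leads past the supremum unless [t] is [b]. *)
pose t := Num.min b (sup S + r / 2).
have tb : t <= b by rewrite ge_min lexx.
have tc : t < sup S + r by rewrite gt_min; apply/orP; right; lra.
have ct : sup S <= t by rewrite le_min (andP acb).2/=; lra.
have rt : reached a e u U t.
  have [st|] := ltP s t; first by apply: (Hr s t) => //; case/andP: sab.
  by move=> ts; have -> : t = s by apply/eqP; rewrite eq_le ts (le_trans sc).
have t_sup : t <= sup S.
  apply: ub_le_sup; first exact: hS.2.
  by split => //; rewrite tb (le_trans _ ct)//; case/andP: acb.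
have [tbE|tltb] := eqVneq t b; first by rewrite -tbE.
move: t_sup; rewrite {1}/t; case: (leP b (sup S + r/2)) => h.
  by move: tltb; rewrite /t (min_idPl h) eqxx.
lra.
Qed.

(** By outer regularity the exceptional set lies in an open [U] of measure below the modulus [d]
    that absolute continuity attaches to [e]. The slopes then contribute [e * (b - a)] and the
    intervals in [U] at most [e], whence the factor [b - a + 1]. *)
Lemma real_ac_derive0 (a b : R) (u : R -> R) : a <= b -> real_ac a b u ->
  {ae mu, forall t, `]a, b[%classic t -> is_derive t 1 u 0} -> u b = u a.
Proof.
rewrite le_eqVlt => /predU1P[->//|ab] acu [N [mN N0 dN]].
suff small e : 0 < e -> `|u b - u a| <= e * (b - a + 1).
  apply/eqP; rewrite -subr_eq0 -normr_le0; apply/ler_addgt0Pr => e e0.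
  rewrite add0r.
  have k0 : 0 < b - a + 1 by lra.
  have := small (e / (b - a + 1)); rewrite divrK ?unitfE ?gt_eqF//; apply.
  exact: divr_gt0.
move=> e0; have [d d0 Hd] := acu _ e0.
(* Nothing is known of the derivative at the two ends; they join the null set so that [U] contains
   them. *)
pose N' := N `|` [set a] `|` [set b].
have mN' : measurable N' by apply: measurableU => //; apply: measurableU.
have N'0 : mu N' = 0.
  have add_point (A : set R) x : measurable A -> mu A = 0%E -> mu (A `|` [set x]) = 0%E.
    move=> mA A0; have h : (mu (A `|` [set x]) <= mu A + mu [set x])%E by exact: measureU2.
    by apply/eqP; rewrite eq_le measure_ge0 andbT (le_trans h)// A0 lebesgue_measure_set1 adde0.
  by apply: (add_point _ b); [exact: measurableU|exact: (add_point N a mN N0)].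
have N'fin : (mu N' < +oo)%E by rewrite N'0.
have [U [oU N'U UN']] := lebesgue_regularity_outer mN' N'fin d0.
have mU : measurable U by exact: open_measurable.
have Ud : (mu U < d%:E)%E.
  have : (mu (U `\` N' `|` N') <= mu (U `\` N') + mu N')%E.
    by apply: measureU2 => //; exact: measurableD.
  by rewrite setUC setDUK// N'0 adde0 => /le_lt_trans; apply.
have [n [s [t [st tr len var]]]] : reached a e u U b.
  apply: reached_end => //.
  - by apply: N'U; left; right.
  - by apply: N'U; right.
  - move=> t tab nUt; apply: contrapT => ndt; apply: nUt; apply: N'U; left; left.
    by apply: dN => /= h; apply: ndt; apply: h; rewrite in_itv.
apply: (le_trans var); rewrite [leRHS]mulrDr mulr1 lerD2l; apply: ltW; apply: (Hd n s t) => //.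
rewrite -lte_fin; apply: (le_lt_trans len); apply: le_lt_trans Ud.
by apply: le_measure; rewrite ?inE//; exact: measurableI.
Qed.

End AbsoluteContinuity.

(** * Integrable real functions and their primitives *)

Section IndefiniteIntegral.
Context {R : realType}.
Local Notation mu := (@lebesgue_measure R).
Implicit Types (f g y : R -> R) (t : R).

Definition real_integrable f : Prop := mu.-integrable setT (EFin \o f).

Definition bounded_measurable f : Prop :=
  measurable_fun setT f /\ exists M : R, forall t, `|f t| <= M.

(** Starting at -oo avoids any case distinction on [t]. For a function that vanishes off []a, b[]
    this is the primitive that vanishes at [a]. *)
Definition indef f t : R := \int[mu]_(x in `]-oo, t]) f x.

Definition total_norm f : R := \int[mu]_x `|f x|.

Lemma ae_imp (P Q : R -> Prop) : (forall t, P t -> Q t) ->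
  {ae mu, forall t, P t} -> {ae mu, forall t, Q t}.
Proof. by move=> PQ; apply: (@filterS _ _ (ae_filter_ringOfSetsType mu)). Qed.

Lemma ae_imp2 (P Q S : R -> Prop) : (forall t, P t -> Q t -> S t) ->
  {ae mu, forall t, P t} -> {ae mu, forall t, Q t} -> {ae mu, forall t, S t}.
Proof. by move=> PQS; apply: (@filterS2 _ _ (ae_filter_ringOfSetsType mu)). Qed.

Lemma real_integrable_measurable f : real_integrable f -> measurable_fun setT f.
Proof. by move=> /measurable_int /measurable_EFinP. Qed.

Lemma real_integrableS f (D : set R) : measurable D -> real_integrable f ->
  mu.-integrable D (EFin \o f).
Proof. by move=> mD; apply: integrableS. Qed.
Hint Resolve real_integrableS : core.

Lemma real_integrableD f g : real_integrable f -> real_integrable g ->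
  real_integrable (fun t => f t + g t).
Proof. by move=> hf hg; exact: (integrableD measurableT hf hg). Qed.

Lemma real_integrableZ (c : R) f : real_integrable f -> real_integrable (fun t => c * f t).
Proof. by move=> hf; exact: (integrableZl measurableT c hf). Qed.

Lemma real_integrableB f g : real_integrable f -> real_integrable g ->
  real_integrable (fun t => f t - g t).
Proof. by move=> hf hg; exact: (integrableB measurableT hf hg). Qed.

Lemma real_integrable0 : real_integrable (fun=> 0).
Proof. exact: integrable0. Qed.

Lemma real_integrable_sum (I : Type) (r : seq I) (F : I -> R -> R) :
  (forall i, real_integrable (F i)) ->
  real_integrable (fun t => \sum_(i <- r) F i t).
Proof.
move=> hF; elim: r => [|i r IH].
  by under eq_fun do rewrite big_nil; exact: real_integrable0.
by under eq_fun do rewrite big_cons; exact: real_integrableD.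
Qed.

Lemma real_integrable_norm f : real_integrable f -> real_integrable (fun t => `|f t|).
Proof. exact: integrable_norm. Qed.

Lemma real_integrable_le f g : measurable_fun setT f ->
  (forall t, `|f t| <= g t) -> real_integrable g -> real_integrable f.
Proof.
move=> mf fg hg; apply: (le_integrable _ _ _ hg) => //; first exact/measurable_EFinP.
by move=> x _ /=; rewrite lee_fin (le_trans (fg x))// ler_norm.
Qed.

Lemma real_integrableM f y : real_integrable f -> bounded_measurable y ->
  real_integrable (fun t => f t * y t).
Proof.
move=> hf [my [M yM]].
apply: (@real_integrable_le _ (fun t => M * `|f t|)).
- by apply: measurable_funM => //; exact: real_integrable_measurable.
- by move=> t; rewrite normrM mulrC ler_wpM2r.
- exact/real_integrableZ/real_integrable_norm.
Qed.

Lemma indefD f g t : real_integrable f -> real_integrable g ->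
  indef (fun x => f x + g x) t = indef f t + indef g t.
Proof. by move=> hf hg; rewrite /indef RintegralD//; exact: real_integrableS. Qed.

Lemma indefB f g t : real_integrable f -> real_integrable g ->
  indef (fun x => f x - g x) t = indef f t - indef g t.
Proof. by move=> hf hg; rewrite /indef RintegralB//; exact: real_integrableS. Qed.

Lemma indefZ c f t : real_integrable f -> indef (fun x => c * f x) t = c * indef f t.
Proof. by move=> hf; rewrite /indef RintegralZl//; exact: real_integrableS. Qed.

Lemma indef0 t : indef (fun=> 0) t = 0.
Proof. by rewrite /indef Rintegral_cst// mul0r. Qed.

Lemma indef_sum (I : Type) (r : seq I) (F : I -> R -> R) t :
  (forall i, real_integrable (F i)) ->
  indef (fun x => \sum_(i <- r) F i x) t = \sum_(i <- r) indef (F i) t.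
Proof.
move=> hF; elim: r => [|i r IH].
  by rewrite big_nil; under eq_fun do rewrite big_nil; exact: indef0.
rewrite big_cons -IH -indefD//; last exact: real_integrable_sum.
by congr (indef _ t); apply/funext => x; rewrite big_cons.
Qed.

Lemma indef_le f g t : real_integrable f -> real_integrable g ->
  (forall x, f x <= g x) -> indef f t <= indef g t.
Proof. by move=> hf hg fg; apply: le_Rintegral => //; exact: real_integrableS. Qed.

Lemma indef_ge0 f t : (forall x, 0 <= f x) -> 0 <= indef f t.
Proof. by move=> f0; apply: Rintegral_ge0. Qed.

Lemma normr_indef f t : real_integrable f -> `|indef f t| <= indef (fun x => `|f x|) t.
Proof. by move=> hf; apply: le_normr_Rintegral => //; exact: real_integrableS. Qed.

Lemma Rintegral_le_total f (D : set R) : measurable D -> real_integrable f ->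
  \int[mu]_(x in D) `|f x| <= total_norm f.
Proof.
move=> mD /real_integrable_norm hf; rewrite /total_norm /Rintegral fine_le//.
- by apply: integrable_fin_num => //; exact: real_integrableS.
- by apply: integrable_fin_num => //.
- apply: ge0_subset_integral => //; exact: (measurable_int mu hf).
Qed.

Lemma indef_le_total f t : real_integrable f -> indef (fun x => `|f x|) t <= total_norm f.
Proof. by move=> hf; exact: Rintegral_le_total. Qed.

Lemma total_norm_ge0 f : 0 <= total_norm f.
Proof. by apply: Rintegral_ge0. Qed.

Lemma normr_indef_total f t : real_integrable f -> `|indef f t| <= total_norm f.
Proof.
by move=> hf; apply: (le_trans (normr_indef _ hf)); exact: indef_le_total.
Qed.

Lemma indef_increment f s t : s <= t -> real_integrable f ->
  indef f t - indef f s = \int[mu]_(x in `]s, t]) f x.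
Proof.
by move=> st hf; rewrite /indef Rintegral_itvB//; exact: real_integrableS.
Qed.

Lemma indef_left f a t : (forall x, x <= a -> f x = 0) -> t <= a -> indef f t = 0.
Proof.
move=> f0 ta; rewrite /indef (@eq_Rintegral _ _ _ _ _ (cst 0)).
  by rewrite Rintegral_cst// mul0r.
by move=> x; rewrite inE/= in_itv/= => xt; apply: f0; exact: le_trans ta.
Qed.

Lemma indef_right f b t : real_integrable f ->
  (forall x, b < x -> f x = 0) -> b <= t -> indef f t = indef f b.
Proof.
move=> hf f0 bt; apply/eqP; rewrite -subr_eq0 indef_increment//.
rewrite (@eq_Rintegral _ _ _ _ _ (cst 0)).
  by rewrite Rintegral_cst// mul0r.
by move=> x; rewrite inE/= in_itv/= => /andP[bx _]; exact: f0.
Qed.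

(** Primitives of nonnegative functions are monotone, hence measurable, and [f] is the difference of
    the nonnegative functions [|f|] and [|f| - f]. *)
Lemma bounded_measurable_indef f : real_integrable f -> bounded_measurable (indef f).
Proof.
move=> hf; split; last by exists (total_norm f) => t; exact: normr_indef_total.
have mono g : real_integrable g -> (forall x, 0 <= g x) -> measurable_fun setT (indef g).
  move=> hg g0; apply: nondecreasing_measurable => // s t st.
  by rewrite -subr_ge0 indef_increment//; exact: Rintegral_ge0.
have -> : indef f = (fun t => indef (fun x => `|f x|) t - indef (fun x => `|f x| - f x) t).
  apply/funext => t; rewrite -indefB; first by congr (indef _ t); apply/funext => x /=; ring.
    exact: real_integrable_norm.
  by apply: real_integrableB => //; exact: real_integrable_norm.
apply: measurable_funB; apply: mono.
- exact: real_integrable_norm.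
- by [].
- by apply: real_integrableB => //; exact: real_integrable_norm.
- by move=> x; rewrite subr_ge0 ler_norm.
Qed.

Lemma indef_real_ac f a b : real_integrable f -> real_ac a b (indef f).
Proof.
move=> hf e e0; have [d [d0 Hd]] := integral_normr_continuous hf e0.
exists d => // n s t st tr len.
pose F i : set R := `]s i, t i[%classic.
have mF i : measurable (F i) by exact: measurable_itv.
have -> : \sum_(i < n) `|indef f (t i) - indef f (s i)| =
    \sum_(i < n) `|\int[mu]_(x in F i) f x|.
  apply: eq_bigr => i _; have [_ sti _] := st i.
  rewrite indef_increment//; last exact: ltW.
  by rewrite -Rintegral_itv_bndo_bndc//; exact: (real_integrableS (measurable_itv _) hf).
have le1 : \sum_(i < n) `|\int[mu]_(x in F i) f x| <=
    \sum_(i < n) \int[mu]_(x in F i) `|f x|.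
  apply: ler_sum => i _; apply: le_normr_Rintegral; [exact: mF|exact: (real_integrableS (mF i) hf)].
apply: (le_lt_trans le1).
(* As the intervals are disjoint, the sum is one integral over their union, to which absolute
   continuity of the integral applies. *)
have <- : \int[mu]_(x in \big[setU/set0]_(i < n) F i) `|f x| =
    \sum_(i < n) \int[mu]_(x in F i) `|f x|.
  rewrite /Rintegral integral_bigsetU_EFin//=.
  - rewrite -[RHS]/(fine (\sum_(i < n) fine (\int[mu]_(x in F i) (`|f x|)%:E))%:E).
    rewrite -sumEFin; congr fine; apply: eq_bigr => i _; rewrite fineK//.
    apply: integrable_fin_num; first exact: mF.
    exact: (real_integrableS (mF i) (real_integrable_norm hf)).
  - exact: index_enum_uniq.
  - by apply: sub_trivIset tr.
  - apply: measurable_funTS; apply/measurable_EFinP; apply: real_integrable_measurable.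
    exact: real_integrable_norm.
apply: Hd; first by apply: bigsetU_measurable => i _; exact: mF.
suff: (mu (\big[setU/set0]_(i < n) F i) < d%:E)%E by [].
have -> : mu (\big[setU/set0]_(i < n) F i) = (\sum_(i < n) mu (F i))%E.
  by apply: measure_bigsetU_ord; [exact: mF|exact: tr].
rewrite (eq_bigr (fun i => (t i - s i)%:E)); first by rewrite sumEFin lte_fin.
move=> i _; have [_ sti _] := st i.
by rewrite /F lebesgue_measure_itv/= lte_fin sti.
Qed.

Lemma indef_derive f : real_integrable f ->
  {ae mu, forall t, is_derive t 1 (indef f) (f t)}.
Proof.
move=> hf.
have hl : locally_integrable [set: R] f by apply: open_integrable_locally => //; exact: openT.
have := FTC1Ny (fun y : R => real_integrableS (measurable_itv _) hf) hl.
by apply: ae_imp => t [? <-]; rewrite derive1E; split.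
Qed.

(** The difference of [u] and [indef g] is absolutely continuous with derivative 0 almost
    everywhere. *)
Lemma real_ac_FTC a b (u g : R -> R) : a <= b -> real_ac a b u -> real_integrable g ->
  {ae mu, forall t, `]a, b[%classic t -> is_derive t 1 u (g t)} ->
  u b - u a = indef g b - indef g a.
Proof.
move=> ab acu hg du.
suff : u b - indef g b = u a - indef g a by lra.
apply: (@real_ac_derive0 _ _ _ (fun t => u t - indef g t)) => //.
  apply: (@real_ac_le2 _ _ _ 1 _ u (indef g)) => //; last exact: indef_real_ac.
  move=> x y _ _; rewrite mul1r; apply: le_trans (ler_normB _ _).
  by rewrite le_eqVlt; apply/orP; left; apply/eqP; congr Num.norm; ring.
apply: ae_imp2 (indef_derive hg) du => t dI /[apply] du.
by rewrite -(subrr (g t)); exact: is_deriveB.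
Qed.

End IndefiniteIntegral.
#[export] Hint Resolve real_integrableS : core.

(** * Matrix-valued functions, entrywise norm and integral *)

Section MatrixFunctions.
Context {R : realType}.

(** This norm is submultiplicative for products of all shapes, and it lets the triangle inequality
    for integrals be applied entry by entry without a constant. *)
Definition mnorm m n (A : 'M[R]_(m, n)) : R := \sum_i \sum_j `|A i j|.

Lemma mnorm_ge0 m n (A : 'M[R]_(m, n)) : 0 <= mnorm A.
Proof. by apply: sumr_ge0 => i _; exact: sumr_ge0. Qed.

Lemma mnorm_entry m n (A : 'M[R]_(m, n)) i j : `|A i j| <= mnorm A.
Proof.
rewrite /mnorm (bigD1 i)//= (bigD1 j)//= -addrA lerDl addr_ge0 ?sumr_ge0// => k _.
exact: sumr_ge0.
Qed.

Lemma mnorm0 m n : mnorm (0 : 'M[R]_(m, n)) = 0.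
Proof. by apply: big1 => i _; apply: big1 => j _; rewrite mxE normr0. Qed.

Lemma mnorm_le0 m n (A : 'M[R]_(m, n)) : mnorm A <= 0 -> A = 0.
Proof.
move=> A0; apply/matrixP => i j; rewrite mxE; apply/eqP; rewrite -normr_le0.
exact: le_trans (mnorm_entry A i j) A0.
Qed.

Lemma mnormD m n (A B : 'M[R]_(m, n)) : mnorm (A + B) <= mnorm A + mnorm B.
Proof.
rewrite /mnorm -big_split; apply: ler_sum => i _ /=; rewrite -big_split.
by apply: ler_sum => j _ /=; rewrite mxE ler_normD.
Qed.

Lemma mnormN m n (A : 'M[R]_(m, n)) : mnorm (- A) = mnorm A.
Proof. by apply: eq_bigr => i _; apply: eq_bigr => j _; rewrite mxE normrN. Qed.

Lemma mnormB m n (A B : 'M[R]_(m, n)) : mnorm (A - B) <= mnorm A + mnorm B.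
Proof. by rewrite -(mnormN B) mnormD. Qed.

Lemma mnormBC m n (A B : 'M[R]_(m, n)) : mnorm (A - B) = mnorm (B - A).
Proof. by rewrite -mnormN opprB. Qed.

Lemma mnormM m n p (A : 'M[R]_(m, n)) (B : 'M[R]_(n, p)) :
  mnorm (A *m B) <= mnorm A * mnorm B.
Proof.
rewrite /mnorm mulr_suml; apply: ler_sum => i _.
apply: (@le_trans _ _ (\sum_j \sum_k `|A i k| * `|B k j|)).
  apply: ler_sum => j _; rewrite mxE (le_trans (ler_norm_sum _ _ _))//.
  by apply: ler_sum => k _; rewrite normrM.
rewrite exchange_big /= mulr_suml; apply: ler_sum => k _.
rewrite -mulr_sumr ler_wpM2l// (bigD1 k)//= lerDl sumr_ge0// => l _.
exact: sumr_ge0.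
Qed.

Lemma mnorm_le_const m n (A : 'M[R]_(m, n)) c : (forall i j, `|A i j| <= c) ->
  mnorm A <= m%:R * n%:R * c.
Proof.
move=> Ac; apply: (@le_trans _ _ (\sum_(i < m) \sum_(j < n) c)).
  by apply: ler_sum => i _; apply: ler_sum => j _.
under eq_bigr do rewrite sumr_const card_ord.
by rewrite sumr_const card_ord -mulrA [leRHS]mulr_natl [n%:R * c]mulr_natl.
Qed.

Definition mx_integrable m n (F : R -> 'M[R]_(m, n)) : Prop :=
  forall i j, real_integrable (fun t => F t i j).

Definition mx_bounded_measurable m n (F : R -> 'M[R]_(m, n)) : Prop :=
  forall i j, bounded_measurable (fun t => F t i j).

Definition mx_indef m n (F : R -> 'M[R]_(m, n)) (t : R) : 'M[R]_(m, n) :=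
  \matrix_(i, j) indef (fun s => F s i j) t.

Definition mx_total m n (F : R -> 'M[R]_(m, n)) : R := total_norm (fun t => mnorm (F t)).

Lemma mx_total_ge0 m n (F : R -> 'M[R]_(m, n)) : 0 <= mx_total F.
Proof. exact: total_norm_ge0. Qed.

Lemma mx_integrableD m n (F G : R -> 'M[R]_(m, n)) :
  mx_integrable F -> mx_integrable G -> mx_integrable (fun t => F t + G t).
Proof.
by move=> hF hG i j; under eq_fun do rewrite mxE; exact: real_integrableD.
Qed.

Lemma mx_integrableB m n (F G : R -> 'M[R]_(m, n)) :
  mx_integrable F -> mx_integrable G -> mx_integrable (fun t => F t - G t).
Proof.
move=> hF hG i j; under eq_fun do rewrite mxE [(- G _) i j]mxE.
exact: real_integrableB.
Qed.

Lemma mx_integrable0 m n : mx_integrable (fun=> 0 : 'M[R]_(m, n)).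
Proof. by move=> i j; under eq_fun do rewrite mxE; exact: real_integrable0. Qed.

Lemma mx_integrableM m n p (A : R -> 'M[R]_(m, n)) (Y : R -> 'M[R]_(n, p)) :
  mx_integrable A -> mx_bounded_measurable Y -> mx_integrable (fun t => A t *m Y t).
Proof.
move=> hA hY i j; under eq_fun do rewrite mxE.
by apply: real_integrable_sum => k; exact: real_integrableM.
Qed.

Lemma mx_integrable_norm m n (F : R -> 'M[R]_(m, n)) :
  mx_integrable F -> real_integrable (fun t => mnorm (F t)).
Proof.
move=> hF; apply: real_integrable_sum => i; apply: real_integrable_sum => j.
exact: real_integrable_norm.
Qed.

Lemma bounded_measurable_cst (c : R) : bounded_measurable (fun=> c).
Proof. by split; [exact: measurable_cst|exists `|c|]. Qed.

Lemma bounded_measurableD (f g : R -> R) : bounded_measurable f ->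
  bounded_measurable g -> bounded_measurable (fun t => f t + g t).
Proof.
move=> [mf [M fM]] [mg [N gN]]; split; first exact: measurable_funD.
by exists (M + N) => t; rewrite (le_trans (ler_normD _ _))// lerD.
Qed.

Lemma bounded_measurableM (f g : R -> R) : bounded_measurable f ->
  bounded_measurable g -> bounded_measurable (fun t => f t * g t).
Proof.
move=> [mf [M fM]] [mg [N gN]]; split; first exact: measurable_funM.
by exists (M * N) => t; rewrite normrM ler_pM.
Qed.

Lemma bounded_measurable_norm (f : R -> R) : bounded_measurable f ->
  bounded_measurable (fun t => `|f t|).
Proof.
move=> [mf [M fM]]; split; first exact: measurableT_comp.
by exists M => t; rewrite normr_id.
Qed.

Lemma bounded_measurable_sum (I : Type) (r : seq I) (F : I -> R -> R) :
  (forall i, bounded_measurable (F i)) ->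
  bounded_measurable (fun t => \sum_(i <- r) F i t).
Proof.
move=> hF; elim: r => [|i r IH].
  by under eq_fun do rewrite big_nil; exact: bounded_measurable_cst.
by under eq_fun do rewrite big_cons; exact: bounded_measurableD.
Qed.

Lemma mx_bounded_measurable_norm m n (F : R -> 'M[R]_(m, n)) :
  mx_bounded_measurable F -> bounded_measurable (fun t => mnorm (F t)).
Proof.
move=> hF; apply: bounded_measurable_sum => i; apply: bounded_measurable_sum => j.
exact: bounded_measurable_norm.
Qed.

Lemma mx_bounded_measurable_cst m n (C : 'M[R]_(m, n)) :
  mx_bounded_measurable (fun=> C).
Proof. by move=> i j; exact: bounded_measurable_cst. Qed.

Lemma mx_bounded_measurableD m n (F G : R -> 'M[R]_(m, n)) :
  mx_bounded_measurable F -> mx_bounded_measurable G ->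
  mx_bounded_measurable (fun t => F t + G t).
Proof.
by move=> hF hG i j; under eq_fun do rewrite mxE; exact: bounded_measurableD.
Qed.

Lemma mx_bounded_measurableM m n p (F : R -> 'M[R]_(m, n)) (G : R -> 'M[R]_(n, p)) :
  mx_bounded_measurable F -> mx_bounded_measurable G ->
  mx_bounded_measurable (fun t => F t *m G t).
Proof.
move=> hF hG i j; under eq_fun do rewrite mxE.
by apply: bounded_measurable_sum => k; exact: bounded_measurableM.
Qed.

Lemma mx_bounded_measurableB m n (F G : R -> 'M[R]_(m, n)) :
  mx_bounded_measurable F -> mx_bounded_measurable G ->
  mx_bounded_measurable (fun t => F t - G t).
Proof.
move=> hF hG i j; under eq_fun do rewrite mxE [(- G _) i j]mxE -mulN1r.
apply: bounded_measurableD => //; apply: bounded_measurableM => //.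
exact: bounded_measurable_cst.
Qed.

Lemma mx_bounded_measurable_indef m n (F : R -> 'M[R]_(m, n)) :
  mx_integrable F -> mx_bounded_measurable (mx_indef F).
Proof.
by move=> hF i j; under eq_fun do rewrite mxE; exact: bounded_measurable_indef.
Qed.

Lemma mx_indefD m n (F G : R -> 'M[R]_(m, n)) t :
  mx_integrable F -> mx_integrable G ->
  mx_indef (fun s => F s + G s) t = mx_indef F t + mx_indef G t.
Proof.
move=> hF hG; apply/matrixP => i j; rewrite !mxE -indefD//.
by congr (indef _ t); apply/funext => s; rewrite mxE.
Qed.

Lemma mx_indefB m n (F G : R -> 'M[R]_(m, n)) t :
  mx_integrable F -> mx_integrable G ->
  mx_indef (fun s => F s - G s) t = mx_indef F t - mx_indef G t.
Proof.
move=> hF hG; apply/matrixP => i j; rewrite !mxE -indefB//.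
by congr (indef _ t); apply/funext => s; rewrite !mxE.
Qed.

Lemma mx_indefMr m n p (F : R -> 'M[R]_(m, n)) (C : 'M[R]_(n, p)) t :
  mx_integrable F -> mx_indef (fun s => F s *m C) t = mx_indef F t *m C.
Proof.
move=> hF; apply/matrixP => i j; rewrite !mxE.
under eq_bigr do rewrite mxE mulrC -indefZ//.
rewrite -indef_sum; last by move=> k; exact: real_integrableZ.
by congr (indef _ t); apply/funext => s; rewrite mxE; apply: eq_bigr => k _; rewrite mulrC.
Qed.

Lemma mnorm_indef m n (F : R -> 'M[R]_(m, n)) t :
  mx_integrable F -> mnorm (mx_indef F t) <= indef (fun s => mnorm (F s)) t.
Proof.
move=> hF; rewrite /mnorm indef_sum; last first.
  by move=> i; apply: real_integrable_sum => j; exact: real_integrable_norm.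
apply: ler_sum => i _; rewrite indef_sum; last first.
  by move=> j; exact: real_integrable_norm.
by apply: ler_sum => j _; rewrite mxE normr_indef.
Qed.

Lemma indef_le_mx_total m n (F : R -> 'M[R]_(m, n)) t : mx_integrable F ->
  indef (fun s => mnorm (F s)) t <= mx_total F.
Proof.
move=> hF; have := indef_le_total t (mx_integrable_norm hF).
by under [X in indef X]eq_fun do rewrite ger0_norm ?mnorm_ge0//.
Qed.

Lemma mx_total_le m n p q (F : R -> 'M[R]_(m, n)) (G : R -> 'M[R]_(p, q)) c :
  mx_integrable F -> mx_integrable G -> (forall t, mnorm (F t) <= c * mnorm (G t)) ->
  mx_total F <= c * mx_total G.
Proof.
move=> hF hG FG; have hnG := real_integrable_norm (mx_integrable_norm hG).
rewrite /mx_total /total_norm -RintegralZl//; apply: le_Rintegral => //.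
- exact/real_integrable_norm/mx_integrable_norm.
- exact: real_integrableZ.
- by move=> t _; rewrite !ger0_norm ?mnorm_ge0.
Qed.

Lemma mx_totalD m n (F G : R -> 'M[R]_(m, n)) :
  mx_integrable F -> mx_integrable G ->
  mx_total (fun t => F t + G t) <= mx_total F + mx_total G.
Proof.
move=> hF hG; have hnF := real_integrable_norm (mx_integrable_norm hF).
have hnG := real_integrable_norm (mx_integrable_norm hG).
rewrite /mx_total /total_norm -RintegralD//; apply: le_Rintegral => //.
- exact/real_integrable_norm/mx_integrable_norm/mx_integrableD.
- exact: real_integrableD.
- by move=> t _; rewrite !ger0_norm ?mnorm_ge0// mnormD.
Qed.

End MatrixFunctions.

(** * Geometric convergence and a weighted Gronwall inequality *)

Section LinearSystems.
Context {R : realType}.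
Local Notation mu := (@lebesgue_measure R).

Lemma le_geometric (x C : R) : (forall k, x <= C * 2^-1 ^+ k) -> x <= 0.
Proof.
move=> xC; rewrite leNgt; apply/negP => x0.
have [k Hk] : exists k : nat, C / x < k%:R.
  exists (Num.bound (C / x)); apply: archi_boundP; apply: divr_ge0; last exact: ltW.
  by have := xC 0%N; rewrite expr0 mulr1; apply: le_trans; exact: ltW.
have := xC k; rewrite exprVn ler_pdivlMr ?exprn_gt0// leNgt => /negP; apply.
move: Hk; rewrite ltr_pdivrMr// mulrC => /lt_le_trans; apply.
apply: ler_wpM2l; first exact: ltW.
by rewrite -natrX ler_nat ltnW// ltn_expl.
Qed.

(** The numbers [u k] minus and plus [2 * C * 2^-1 ^+ k] bound nested intervals, so the supremum of
    the lower ends is a limit with the stated rate. *)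
Lemma geometric_limit (u : nat -> R) (C : R) : 0 <= C ->
  (forall k, `|u k.+1 - u k| <= C * 2^-1 ^+ k) ->
  exists l, forall k, `|l - u k| <= 2 * C * 2^-1 ^+ k.
Proof.
move=> C0 uC; pose v k := u k - 2 * C * 2^-1 ^+ k; pose w k := u k + 2 * C * 2^-1 ^+ k.
have step k : v k <= v k.+1 /\ w k.+1 <= w k.
  have := uC k; rewrite ler_norml => /andP[h1 h2].
  rewrite /v /w exprS; split; lra.
have vmono : {homo v : i j / (i <= j)%N >-> i <= j}.
  by apply: homo_leq => // [y x z|k]; [exact: le_trans|exact: (step k).1].
have wmono : {homo w : i j / (i <= j)%N >-> j <= i}.
  apply: (@homo_leq _ w (fun x y => y <= x)) => // [y x z h1 h2|k]; last exact: (step k).2.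
  exact: le_trans h2 h1.
have vw i j : v i <= w j.
  apply: (@le_trans _ _ (v (maxn i j))); first by apply: vmono; exact: leq_maxl.
  apply: (@le_trans _ _ (w (maxn i j))); last by apply: wmono; exact: leq_maxr.
  have : 0 <= 2 * C * 2^-1 ^+ maxn i j by rewrite mulr_ge0 ?mulr_ge0// exprn_ge0.
  by rewrite /v /w; lra.
have hS : has_sup [set x | exists k, x = v k].
  split; first by exists (v 0%N), 0%N.
  by exists (w 0%N) => _ [k ->].
exists (sup [set x | exists k, x = v k]) => k; rewrite ler_norml.
have h1 : v k <= sup [set x | exists k, x = v k].
  by apply: ub_le_sup; [exact: hS.2|exists k].
have h2 : sup [set x | exists k, x = v k] <= w k.
  by apply: ge_sup; [exact: hS.1|move=> _ [j ->]].
by move: h1 h2; rewrite /v /w => h1 h2; apply/andP; split; lra.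
Qed.

Lemma measurable_geometric_limit (u : nat -> R -> R) (l : R -> R) (C : R) :
  (forall k, measurable_fun setT (u k)) ->
  (forall k t, `|l t - u k t| <= C * 2^-1 ^+ k) -> measurable_fun setT l.
Proof.
move=> mu_ ul; apply: (@measurable_fun_cvg _ _ _ _ u) => // t _.
apply/cvgrPdist_le => e e0.
have : (fun k => C * 2^-1 ^+ k) @ \oo --> C * 0.
  apply: cvgM; first exact: cvg_cst.
  by apply: cvg_expr; rewrite ger0_norm ?invf_lt1// ltr1n.
rewrite mulr0 => /cvgrPdist_le /(_ _ e0); apply: filterS => k.
rewrite sub0r normrN => h; apply: le_trans (ul k t) (le_trans (ler_norm _) h).
Qed.

Section Weight.
Variables (a b : R) (k : R -> R).
Hypotheses (ab : a < b) (hk : real_integrable k) (k_ge0 : forall t, 0 <= k t).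
Hypothesis k_supp : forall t, ~ `]a, b[%classic t -> k t = 0.

(** A Bielecki weight: the 2 in the exponent makes the integral operator with kernel [k] a
    contraction of factor 1/2 for the sup of [|y| / weight]. *)
Definition weight t : R := expR (2 * indef k t).

Lemma weight_ge1 t : 1 <= weight t.
Proof. by rewrite -expR0 ler_expR mulr_ge0// indef_ge0. Qed.

Lemma weight_le t : weight t <= expR (2 * total_norm k).
Proof.
rewrite ler_expR ler_wpM2l//; apply: le_trans (normr_indef_total t hk); exact: ler_norm.
Qed.

Lemma bounded_measurable_weight : bounded_measurable weight.
Proof.
split; last by exists (expR (2 * total_norm k)) => t; rewrite ger0_norm ?expR_ge0 ?weight_le.
apply: measurableT_comp; first exact: measurable_expR.
apply: measurable_funM => //; exact: (bounded_measurable_indef hk).1.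
Qed.

Let real_ac_weight x y : real_ac x y weight.
Proof.
pose E := expR (2 * total_norm k).
apply: (@real_ac_le2 _ _ _ E _ (indef k) (indef k)).
- exact: expR_ge0.
- have one_side s t : indef k s <= indef k t ->
      `|weight t - weight s| <= E * (`|indef k t - indef k s| + `|indef k t - indef k s|).
    move=> st; rewrite !ger0_norm ?subr_ge0//; last by rewrite ler_expR ler_wpM2l.
    (* From [1 + x <= expR x] the increment of the weight is at most [2 * weight t] times that of
       [indef k]. The 2 is provided by using [indef k] as both dominating functions. *)
    have e1 := expR_ge1Dx (2 * indef k s - 2 * indef k t).
    have e2 : weight s = weight t * expR (2 * indef k s - 2 * indef k t).
      by rewrite -expRD; congr expR; ring.
    have wE := weight_le t; rewrite -/E in wE.
    have w0 : 0 <= weight t := expR_ge0 _.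
    have d0 : 0 <= indef k t - indef k s by rewrite subr_ge0.
    rewrite e2; move: e1 wE w0 d0; move: (expR _) (weight t) => z w e1 wE w0 d0.
    have h1 : w * (1 + (2 * indef k s - 2 * indef k t)) <= w * z by exact: ler_wpM2l.
    have h2 : w * (indef k t - indef k s) <= E * (indef k t - indef k s) by exact: ler_wpM2r.
    lra.
  move=> s t _ _; have [st|/ltW st] := leP (indef k s) (indef k t).
    rewrite distrC [`|indef k s - _|]distrC; exact: one_side.
  exact: one_side.
- exact: indef_real_ac.
- exact: indef_real_ac.
Qed.

(* e^(2K)/2 is a primitive of k e^(2K). *)
Lemma indef_weight t : indef (fun s => k s * weight s) t <= weight t / 2.
Proof.
have hkw := real_integrableM hk bounded_measurable_weight.
have wt_ge0 s : 0 <= weight s / 2 by rewrite divr_ge0 ?expR_ge0.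
have kl s : s <= a -> k s = 0.
  by move=> sa; apply: k_supp; rewrite /= in_itv/= => /andP[/lt_le_trans/(_ sa)]; rewrite ltxx.
have kr s : b < s -> k s = 0.
  move=> bs; apply: k_supp; rewrite /= in_itv/= => /andP[_ /(lt_trans bs)].
  by rewrite ltxx.
have kwl s : s <= a -> indef (fun s => k s * weight s) s = 0.
  by move=> sa; apply: (@indef_left _ _ a) => // x xa; rewrite kl// mul0r.
have main s : a <= s -> s <= b -> indef (fun s => k s * weight s) s <= weight s / 2.
  move=> as_ sb; have := @real_ac_FTC _ a s (fun x => weight x / 2) _ as_ _ hkw.
  rewrite (kwl a)// subr0 => <-; first by rewrite lerBlDr lerDl.
    apply: (@real_ac_le2 _ _ _ 1 _ weight weight) => // x y _ _.
    rewrite mul1r -mulrBl normrM; have := normr_ge0 (weight x - weight y).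
    by rewrite [`|2^-1|]ger0_norm//; lra.
  apply: ae_imp (indef_derive hk) => x dK _.
  have dw := @is_derive1_comp _ expR (2 \*: indef k) x _ _
    (is_derive_expR (2 * indef k x)) (is_deriveZ 2 dK).
  have dw2 := is_deriveZ 2^-1 dw.
  have -> : (fun x : R => weight x / 2) = 2^-1 \*: (expR \o (2 \*: indef k)).
    by apply/funext => z; rewrite /= mulrC.
  by apply: is_derive_eq dw2 _; rewrite /weight /GRing.scale/=; field.
have [ta|/ltW at_] := leP t a; first by rewrite kwl.
have [|/ltW bt] := leP t b; first exact: main.
rewrite (indef_right hkw (b := b))//; last by move=> s bs; rewrite kr ?mul0r.
by rewrite {2}/weight (indef_right hk (b := b))//; apply: main => //; exact: ltW.
Qed.

(** The supremum [D] of [y / weight] is finite because [y] is bounded, and the hypothesis on [y]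
    yields [D <= c + D / 2]. Continuity of [y] does not enter. *)
Lemma weighted_gronwall (y : R -> R) (c : R) : bounded_measurable y ->
  0 <= c -> (forall t, 0 <= y t) ->
  (forall t, y t <= c + indef (fun s => k s * y s) t) ->
  forall t, y t <= 2 * c * weight t.
Proof.
move=> hy c0 y0 yc; pose S := [set x | exists t, x = y t / weight t].
have w0 t : 0 < weight t := expR_gt0 _.
have hS : has_sup S.
  split; first by exists (y 0 / weight 0), 0.
  have [_ [M yM]] := hy; exists M => _ [t ->].
  rewrite ler_pdivrMr// (le_trans (le_trans (ler_norm _) (yM t)))//.
  by rewrite ler_peMr ?weight_ge1// (le_trans _ (yM 0)).
pose D := sup S.
have yD t : y t <= D * weight t.
  by rewrite -ler_pdivrMr//; apply: ub_le_sup; [exact: hS.2|exists t].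
have D0 : 0 <= D.
  by have := le_trans (y0 0) (yD 0); rewrite pmulr_lge0.
suff D2c : D <= 2 * c.
  by move=> t; apply: (le_trans (yD t)); apply: ler_wpM2r => //; exact: ltW.
suff : D <= c + D / 2 by lra.
apply: ge_sup => [|_ [t ->]]; first exact: hS.1.
rewrite ler_pdivrMr//; apply: (le_trans (yc t)).
have h1 : indef (fun s => k s * y s) t <= D * indef (fun s => k s * weight s) t.
  have hkw := real_integrableM hk bounded_measurable_weight.
  rewrite -indefZ//; apply: indef_le.
  - exact: real_integrableM.
  - exact: real_integrableZ.
  - by move=> x; rewrite mulrCA; apply: ler_wpM2l.
have h2 := ler_wpM2l D0 (indef_weight t).
have h3 := ler_wpM2l c0 (weight_ge1 t).
lra.
Qed.

End Weight.

End LinearSystems.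

(** * Initial value problem for linear systems with integrable coefficients *)

Section InitialValueProblem.
Context {R : realType} (a b : R) (ab : a < b).

Definition supported m n (A : R -> 'M[R]_(m, n)) : Prop :=
  forall t, ~ `]a, b[%classic t -> A t = 0.

(** With [n] columns, fundamental matrices and vector solutions share one theory. When [A] and [F]
    vanish off []a, b[], a solution is constant on either side of the interval, and [y0] is its
    value at [a]. *)
Definition solves m n (A : R -> 'M[R]_m) (F : R -> 'M[R]_(m, n)) y0 Y : Prop :=
  mx_bounded_measurable Y /\
  forall t, Y t = y0 + mx_indef (fun s => A s *m Y s + F s) t.

Section Existence.
Variables (m n : nat) (A : R -> 'M[R]_m).
Hypotheses (hA : mx_integrable A) (sA : supported A).
Implicit Types F Y : R -> 'M[R]_(m, n).

Let k t := mnorm (A t).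
Let hk : real_integrable k. Proof. exact: mx_integrable_norm. Qed.
Let k_ge0 t : 0 <= k t. Proof. exact: mnorm_ge0. Qed.
Let k_supp t : ~ `]a, b[%classic t -> k t = 0.
Proof. by move=> /sA At; rewrite /k At mnorm0. Qed.

Let w := weight k.

Let w_le t : w t <= expR (2 * mx_total A).
Proof. exact: weight_le. Qed.

Lemma mnorm_indefM Y t : mx_bounded_measurable Y ->
  mnorm (mx_indef (fun s => A s *m Y s) t) <= indef (fun s => k s * mnorm (Y s)) t.
Proof.
move=> hY; have hAY := mx_integrableM hA hY.
apply: (le_trans (mnorm_indef _ hAY)); apply: indef_le.
- exact: mx_integrable_norm.
- apply: real_integrableM; [exact: hk|exact: mx_bounded_measurable_norm].
- by move=> s; exact: mnormM.
Qed.

Lemma solves_bound F y0 Y : mx_integrable F -> solves A F y0 Y ->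
  forall t, mnorm (Y t) <= 2 * (mnorm y0 + mx_total F) * expR (2 * mx_total A).
Proof.
move=> hF [hY eqY] t; have hAY := mx_integrableM hA hY.
have c0 : 0 <= mnorm y0 + mx_total F by rewrite addr_ge0 ?mnorm_ge0 ?mx_total_ge0.
apply: (@le_trans _ _ (2 * (mnorm y0 + mx_total F) * w t)); last first.
  by apply: ler_wpM2l; [rewrite mulr_ge0|exact: w_le].
apply: (weighted_gronwall ab hk k_ge0 k_supp (y := fun t => mnorm (Y t))) => //.
- exact: mx_bounded_measurable_norm.
- by move=> s; exact: mnorm_ge0.
move=> s; rewrite {1}eqY mx_indefD// -addrA; apply: (le_trans (mnormD _ _)).
rewrite lerD2l addrC; apply: (le_trans (mnormD _ _)); apply: lerD.
  exact: mnorm_indefM.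
exact: le_trans (mnorm_indef _ hF) (indef_le_mx_total _ hF).
Qed.

(** Picard iteration: in the norm weighted by [w], each step halves the distance between successive
    iterates. *)
Lemma solves_exists F y0 : mx_integrable F -> exists Y, solves A F y0 Y.
Proof.
move=> hF.
pose T Y t := y0 + mx_indef (fun s => A s *m Y s + F s) t.
have bmT Y : mx_bounded_measurable Y -> mx_bounded_measurable (T Y).
  move=> hY; apply: mx_bounded_measurableD; first exact: mx_bounded_measurable_cst.
  apply: mx_bounded_measurable_indef; apply: mx_integrableD => //.
  exact: mx_integrableM.
have TB X Y t : mx_bounded_measurable X -> mx_bounded_measurable Y ->
    mnorm (T X t - T Y t) <= indef (fun s => k s * mnorm (X s - Y s)) t.
  move=> hX hY; have hXY := mx_bounded_measurableB hX hY.
  rewrite /T opprD addrACA subrr add0r !mx_indefD ?mx_integrableM//;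
    try by apply: mx_integrableM.
  rewrite opprD addrACA subrr addr0 -mx_indefB; try by apply: mx_integrableM.
  under [X in mx_indef X]eq_fun do rewrite -mulmxBr.
  exact: mnorm_indefM.
(* Starting from 0, the first increment is [y0] plus the integral of [F], which [D] bounds; for the
   same reason the limit is bounded by [2 * C]. *)
pose Y_ := fix Y_ j := if j is j'.+1 then T (Y_ j') else fun=> 0.
have bmY j : mx_bounded_measurable (Y_ j).
  by elim: j => [|j IH] /=; [exact: mx_bounded_measurable_cst|exact: bmT].
pose D := mnorm y0 + mx_total F.
have D0 : 0 <= D by rewrite addr_ge0 ?mnorm_ge0 ?mx_total_ge0.
have step j t : mnorm (Y_ j.+1 t - Y_ j t) <= D * 2^-1 ^+ j * w t.
  elim: j t => [|j IH] t.
    rewrite expr0 mulr1 subr0; apply: (@le_trans _ _ D); last first.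
      by rewrite ler_peMr// weight_ge1.
    apply: (le_trans (mnormD _ _)); rewrite lerD2l.
    under [X in mx_indef X]eq_fun do rewrite mulmx0 add0r.
    exact: le_trans (mnorm_indef _ hF) (indef_le_mx_total _ hF).
  apply: (le_trans (TB _ _ t (bmY j.+1) (bmY j))).
  have hkw := real_integrableM hk (bounded_measurable_weight hk).
  have c0 : 0 <= D * 2^-1 ^+ j by rewrite mulr_ge0 ?exprn_ge0.
  apply: (@le_trans _ _ (D * 2^-1 ^+ j * indef (fun s => k s * w s) t)).
    rewrite -indefZ//; apply: indef_le.
    - apply: real_integrableM => //; apply: mx_bounded_measurable_norm.
      by apply: mx_bounded_measurableB.
    - exact: real_integrableZ.
    - by move=> s; rewrite mulrCA; apply: ler_wpM2l; [exact: k_ge0|exact: IH].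
  have := ler_wpM2l c0 (indef_weight ab hk k_supp t).
  by rewrite -/w exprS; lra.
pose C := D * expR (2 * mx_total A).
have C0 : 0 <= C by rewrite mulr_ge0 ?expR_ge0.
have stepC j t i l : `|Y_ j.+1 t i l - Y_ j t i l| <= C * 2^-1 ^+ j.
  have := mnorm_entry (Y_ j.+1 t - Y_ j t) i l; rewrite !mxE => /le_trans; apply.
  apply: (le_trans (step j t)); rewrite /C -!mulrA; apply: ler_wpM2l => //.
  by rewrite mulrC; apply: ler_wpM2r; [rewrite exprn_ge0|exact: w_le].
pose lim t i l := sval (cid (geometric_limit C0 (fun j => stepC j t i l))).
pose Y t : 'M[R]_(m, n) := \matrix_(i, l) lim t i l.
have Ylim j t i l : `|Y t i l - Y_ j t i l| <= 2 * C * 2^-1 ^+ j.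
  by rewrite mxE /lim; case: cid => x /=.
pose E := m%:R * n%:R * (2 * C).
have YE j t : mnorm (Y t - Y_ j t) <= E * 2^-1 ^+ j.
  rewrite -mulrA; apply: mnorm_le_const => i l.
  by have := Ylim j t i l; rewrite !mxE.
have bmY' : mx_bounded_measurable Y.
  move=> i l; split.
    apply: (@measurable_geometric_limit _ (fun j t => Y_ j t i l) _ (2 * C)).
      by move=> j; exact: (bmY j i l).1.
    by move=> j t; exact: Ylim.
  exists (2 * C) => t; have := Ylim 0%N t i l.
  by rewrite expr0 mulr1 /= [X in _ - X]mxE subr0.
exists Y; split => // t.
apply/eqP; rewrite -subr_eq0; apply/eqP; apply: mnorm_le0.
apply: (@le_geometric _ _ (E + E * mx_total A)) => j.
(* Since iterate [j.+1] is [T] of iterate [j], the residual splits into two terms: one is bounded by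
   the distance from [Y] to its iterates, the other by that distance times the total norm of [A]. *)
have -> : Y t - (y0 + mx_indef (fun s => A s *m Y s + F s) t) =
    (Y t - Y_ j.+1 t) + (T (Y_ j) t - T Y t) by rewrite addrA subrK.
apply: (le_trans (mnormD _ _)); rewrite mulrDl; apply: lerD.
  apply: (le_trans (YE j.+1 t)); rewrite exprS mulrCA.
  have : 0 <= E * 2^-1 ^+ j by rewrite (le_trans (mnorm_ge0 _) (YE j t)).
  lra.
apply: (le_trans (TB _ _ t (bmY j) bmY')).
apply: (@le_trans _ _ (E * 2^-1 ^+ j * indef k t)).
  rewrite -indefZ//; apply: indef_le.
  - apply: real_integrableM => //; apply: mx_bounded_measurable_norm.
    by apply: mx_bounded_measurableB.
  - exact: real_integrableZ.
  - move=> s; rewrite mulrC; apply: ler_wpM2r; first exact: k_ge0.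
    by rewrite mnormBC.
rewrite [leRHS]mulrAC; apply: ler_wpM2l; last exact: indef_le_mx_total.
by rewrite (le_trans (mnorm_ge0 _) (YE j t)).
Qed.

End Existence.

Lemma solvesB m n (A : R -> 'M[R]_m) (F G : R -> 'M[R]_(m, n)) y0 z0 Y Z :
  mx_integrable A -> mx_integrable F -> mx_integrable G ->
  solves A F y0 Y -> solves A G z0 Z ->
  solves A (fun t => F t - G t) (y0 - z0) (fun t => Y t - Z t).
Proof.
move=> hA hF hG [hY eqY] [hZ eqZ]; split; first exact: mx_bounded_measurableB.
move=> t; rewrite [in LHS]eqY [in LHS]eqZ opprD addrACA; congr (_ + _).
rewrite -mx_indefB; try by apply: mx_integrableD => //; exact: mx_integrableM.
congr (mx_indef _ t); apply/funext => s.
by rewrite mulmxBr opprD addrACA.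
Qed.

Lemma solvesMr m n p (A : R -> 'M[R]_m) (y0 : 'M[R]_(m, n)) Y (C : 'M[R]_(n, p)) :
  mx_integrable A -> solves A (fun=> 0) y0 Y ->
  solves A (fun=> 0) (y0 *m C) (fun t => Y t *m C).
Proof.
move=> hA [hY eqY]; split.
  by apply: mx_bounded_measurableM => //; exact: mx_bounded_measurable_cst.
move=> t; rewrite [in LHS]eqY mulmxDl; congr (_ + _); rewrite -mx_indefMr.
  by congr (mx_indef _ t); apply/funext => s; rewrite !addr0 mulmxA.
by apply: mx_integrableD; [exact: mx_integrableM|exact: mx_integrable0].
Qed.

Lemma solves_eq0 m n (A : R -> 'M[R]_m) (Y : R -> 'M[R]_(m, n)) :
  mx_integrable A -> supported A -> solves A (fun=> 0) 0 Y -> forall t, Y t = 0.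
Proof.
move=> hA sA solY t; apply: mnorm_le0.
apply: (le_trans (solves_bound hA sA (@mx_integrable0 _ _ _) solY t)).
rewrite mnorm0 /mx_total /total_norm (_ : (fun x => _) = cst 0).
  by rewrite Rintegral_cst//= mul0r addr0 mulr0 mul0r.
by apply/funext => x; rewrite mnorm0 normr0.
Qed.

Lemma solves_left m n (A : R -> 'M[R]_m) (F : R -> 'M[R]_(m, n)) y0 Y :
  supported A -> supported F -> solves A F y0 Y -> Y a = y0.
Proof.
move=> sA sF [_ ->]; rewrite [X in _ + X](_ : _ = 0) ?addr0//.
apply/matrixP => i j; rewrite !mxE; apply: (@indef_left _ _ a) => // t ta.
have nt : ~ `]a, b[%classic t.
  by rewrite /= in_itv/= => /andP[/lt_le_trans/(_ ta)]; rewrite ltxx.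
by rewrite sA// sF// mul0mx addr0 mxE.
Qed.

End InitialValueProblem.

(** * Two-point boundary value problem and its perturbation *)

Section BoundaryValueProblem.
Context {R : realType} (a b : R) (ab : a < b) (m : nat).
Implicit Types (A : R -> 'M[R]_m) (F Y : R -> 'cV[R]_m) (al be : 'M[R]_m) (g : 'cV[R]_m).

Definition solves_bvp A al be F g Y : Prop :=
  (exists y0, solves A F y0 Y) /\ al *m Y a + be *m Y b = g.

Definition nondegenerate A al be : Prop :=
  forall Y, solves_bvp A al be (fun=> 0) 0 Y -> forall t, Y t = 0.

(** The kernel [kermx] acts on row vectors from the left, hence the passage to the transpose. *)
Lemma unitmx_injective (M : 'M[R]_m) :
  (forall c : 'cV[R]_m, M *m c = 0 -> c = 0) -> M \in unitmx.
Proof.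
move=> injM; rewrite -unitmx_tr -row_free_unit -kermx_eq0.
apply/eqP/row_matrixP => i; rewrite row0.
apply: trmx_inj; rewrite trmx0; apply: injM.
apply: trmx_inj; rewrite trmx_mul trmxK trmx0 -row_mul mulmx_ker row0 //.
Qed.

Section Nondegenerate.
Variables (A : R -> 'M[R]_m) (al be : 'M[R]_m).
Hypotheses (hA : mx_integrable A) (sA : supported a b A) (nd : nondegenerate A al be).

Let supp0 n : supported a b (fun=> 0 : 'M[R]_(m, n)).
Proof. by []. Qed.

(** If [c] is in the kernel of [al + be *m Phi b], then [Phi c] solves the homogeneous boundary
    value problem, so it vanishes; its value at [a] is [c]. *)
Let fundamental : exists Phi : R -> 'M[R]_m,
  solves A (fun=> 0) 1%:M Phi /\ al + be *m Phi b \in unitmx.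
Proof.
have [Phi sol] := solves_exists ab hA sA 1%:M (@mx_integrable0 _ m m).
have Pa : Phi a = 1%:M := solves_left sA (@supp0 m) sol.
exists Phi; split => //; apply: unitmx_injective => c Mc.
have solc := solvesMr c hA sol; rewrite mul1mx in solc.
have : solves_bvp A al be (fun=> 0) 0 (fun t => Phi t *m c).
  split; first by exists c.
  by rewrite Pa mul1mx mulmxA -mulmxDl.
by move=> /nd /(_ a); rewrite Pa mul1mx.
Qed.

(** The solution [Z] with zero initial value is corrected by a homogeneous solution [Phi c], and the
    boundary condition becomes a linear equation for [c]. *)
Lemma bvp_exists F : mx_integrable F -> supported a b F ->
  exists Y, solves_bvp A al be F 0 Y.
Proof.
move=> hF sF; have [Phi [solP uM]] := fundamental.
have [Z solZ] := solves_exists ab hA sA 0 hF.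
pose c := invmx (al + be *m Phi b) *m (be *m Z b).
have solc := solvesMr c hA solP; rewrite mul1mx in solc.
have Mc : (al + be *m Phi b) *m c = be *m Z b by rewrite mulmxA mulmxV// mul1mx.
move: c solc Mc => c solc Mc.
have solY := solvesB hA hF (@mx_integrable0 _ m 1) solZ solc.
exists (fun t => Z t - Phi t *m c); split.
  by exists (0 - c); move: solY; under [X in solves A X]eq_fun do rewrite subr0.
have Pa : Phi a = 1%:M := solves_left sA (@supp0 m) solP.
have Za : Z a = 0 := solves_left sA sF solZ.
by rewrite Za Pa mul1mx sub0r mulmxN mulmxBr -Mc mulmxDl -mulmxA addrK addNr.
Qed.

Lemma bvp_bound : exists2 K : R, 0 < K & forall F g Y,
  mx_integrable F -> supported a b F -> solves_bvp A al be F g Y ->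
  forall t, mnorm (Y t) <= K * (mnorm g + mx_total F).
Proof.
have [Phi [solP uM]] := fundamental.
pose E := 2 * expR (2 * mx_total A).
have E0 : 0 < E by rewrite mulr_gt0 ?expR_gt0.
pose N := mnorm (invmx (al + be *m Phi b)).
have N0 : 0 <= N by exact: mnorm_ge0.
(* With f the total norm of [F], Gronwall gives [|Z b| <= E f] and [|Y| <= E (|y0| + f)]. The
   boundary condition gives [|y0| <= N (|g| + |be| E f)]. *)
exists (E * (N * (1 + mnorm be * E) + 1)).
  by rewrite mulr_gt0// ltr_wpDl// mulr_ge0// addr_ge0// mulr_ge0 ?mnorm_ge0 ?ltW.
move=> F g Y hF sF [[y0 solY] bc] t.
have [Z solZ] := solves_exists ab hA sA 0 hF.
have Pa : Phi a = 1%:M := solves_left sA (@supp0 m) solP.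
have Za : Z a = 0 := solves_left sA sF solZ.
have Ya : Y a = y0 := solves_left sA sF solY.
have YE s : Y s = Z s + Phi s *m y0.
  have h1 := solvesB hA hF hF solY solZ; rewrite subr0 in h1.
  have h2 := solvesMr y0 hA solP; rewrite mul1mx in h2.
  have hFF : mx_integrable (fun t => F t - F t) by exact: mx_integrableB.
  have h3 := solvesB hA hFF (@mx_integrable0 _ m 1) h1 h2; rewrite subrr in h3.
  have h4 : solves A (fun=> 0) 0 (fun t => Y t - Z t - Phi t *m y0).
    by move: h3; under [X in solves A X]eq_fun do rewrite subrr subr0.
  by have /eqP := solves_eq0 ab hA sA h4 s; rewrite -addrA -opprD subr_eq0 => /eqP.
have y0E : y0 = invmx (al + be *m Phi b) *m (g - be *m Z b).
  have <- : (al + be *m Phi b) *m y0 = g - be *m Z b.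
    by rewrite -bc Ya (YE b) mulmxDr mulmxDl mulmxA [X in _ + X - _]addrC addrA addrK.
  by rewrite mulmxA mulVmx// mul1mx.
pose f := mx_total F.
have f0 : 0 <= f := mx_total_ge0 _.
have g0 := mnorm_ge0 g.
have Zb : mnorm (Z b) <= E * f.
  have := solves_bound ab hA sA hF solZ b; rewrite mnorm0 add0r => h.
  by rewrite /E mulrAC.
have y0b : mnorm y0 <= N * (mnorm g + mnorm be * (E * f)).
  rewrite y0E (le_trans (mnormM _ _))//; apply: ler_wpM2l => //.
  rewrite (le_trans (mnormB _ _))// lerD2l (le_trans (mnormM _ _))//.
  by apply: ler_wpM2l => //; exact: mnorm_ge0.
have := solves_bound ab hA sA hF solY t => /le_trans; apply.
rewrite mulrAC -/E -/f -mulrA; apply: ler_wpM2l; first exact: ltW.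
apply: (@le_trans _ _ (N * (mnorm g + mnorm be * (E * f)) + f)); first by rewrite lerD2r.
have be0 := mnorm_ge0 be.
have h1 : 0 <= N * (mnorm be * E * mnorm g).
  by rewrite !mulr_ge0// ltW.
have h2 : 0 <= N * f by rewrite mulr_ge0.
lra.
Qed.

End Nondegenerate.

Lemma solves_bvp_perturb A A1 al al1 be be1 F g Y :
  mx_integrable A -> mx_integrable A1 -> mx_integrable F ->
  solves_bvp A1 al1 be1 F g Y ->
  solves_bvp A al be (fun t => F t + (A1 t - A t) *m Y t)
    (g - ((al1 - al) *m Y a + (be1 - be) *m Y b)) Y.
Proof.
move=> hA hA1 hF [[y0 [hY eqY]] bc]; split.
  exists y0; split => // t; rewrite [in LHS]eqY; congr (_ + mx_indef _ t).
  by apply/funext => s; rewrite mulmxBl addrCA [A s *m Y s + _]addrC subrK addrC.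
rewrite -bc !mulmxBl; move: (al *m _) (be *m _) (al1 *m _) (be1 *m _) => u v u1 v1.
by apply/matrixP => i j; rewrite !mxE; ring.
Qed.

(** For a bound [S] of [Y1], source error and boundary error together are at most [d * S], so
    [K * d <= 2^-1] lets the sup of [Y1] be absorbed on the left; this doubles [K]. *)
Lemma bvp_perturbation A al be : mx_integrable A -> supported a b A ->
  nondegenerate A al be -> exists2 K : R, 0 < K & forall A1 al1 be1 (d : R),
    mx_integrable A1 -> supported a b A1 -> K * d <= 2^-1 ->
    mx_total (fun t => A1 t - A t) + mnorm (al1 - al) + mnorm (be1 - be) <= d ->
    forall F Y1, mx_integrable F -> supported a b F -> solves_bvp A1 al1 be1 F 0 Y1 ->
      (forall t, mnorm (Y1 t) <= 2 * K * mx_total F) /\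
      (forall Y, solves_bvp A al be F 0 Y ->
        forall t, mnorm (Y1 t - Y t) <= 2 * K ^+ 2 * d * mx_total F).
Proof.
move=> hA sA nd; have [K K0 HK] := bvp_bound hA sA nd; exists K => // A1 al1 be1 d hA1 sA1.
move=> Kd dE F Y1 hF sF sol1.
have hY1 : mx_bounded_measurable Y1 by case: sol1 => [[y0 []]].
have hD : mx_integrable (fun t => A1 t - A t) by exact: mx_integrableB.
have hDY : mx_integrable (fun t => (A1 t - A t) *m Y1 t) by exact: mx_integrableM.
have sDY : supported a b (fun t => (A1 t - A t) *m Y1 t).
  by move=> t nt; rewrite sA1// sA// subrr mul0mx.
pose g := (al1 - al) *m Y1 a + (be1 - be) *m Y1 b.
have small S : (forall t, mnorm (Y1 t) <= S) ->
    mnorm g + mx_total (fun t => (A1 t - A t) *m Y1 t) <= d * S.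
  move=> YS; have S0 : 0 <= S := le_trans (mnorm_ge0 _) (YS 0).
  have h1 : mnorm g <= mnorm (al1 - al) * S + mnorm (be1 - be) * S.
    apply: (le_trans (mnormD _ _)); apply: lerD; apply: (le_trans (mnormM _ _));
      by apply: ler_wpM2l; [exact: mnorm_ge0|exact: YS].
  have h2 : mx_total (fun t => (A1 t - A t) *m Y1 t) <= S * mx_total (fun t => A1 t - A t).
    apply: mx_total_le => // t; apply: (le_trans (mnormM _ _)); rewrite mulrC.
    by apply: ler_wpM2r; [exact: mnorm_ge0|exact: YS].
  have h3 := ler_wpM2r S0 dE.
  lra.
have sol0 := solves_bvp_perturb al be hA hA1 hF sol1.
rewrite sub0r -/g in sol0.
have step S : (forall t, mnorm (Y1 t) <= S) ->
    forall t, mnorm (Y1 t) <= K * mx_total F + S / 2.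
  move=> YS t; have S0 : 0 <= S := le_trans (mnorm_ge0 _) (YS 0).
  have hFD : mx_integrable (fun t => F t + (A1 t - A t) *m Y1 t) by exact: mx_integrableD.
  have sFD : supported a b (fun t => F t + (A1 t - A t) *m Y1 t).
    by move=> x nx; rewrite sF// sDY// addr0.
  have := HK _ _ _ hFD sFD sol0 t => /le_trans; apply.
  have h1 := small _ YS; have h2 := mx_totalD hF hDY.
  have h3 : mnorm (- g) + mx_total (fun t => F t + (A1 t - A t) *m Y1 t) <=
      mx_total F + d * S by rewrite mnormN; lra.
  have h4 := ler_wpM2l (ltW K0) h3.
  have h5 := ler_wpM2r S0 Kd.
  lra.
have bound t : mnorm (Y1 t) <= 2 * K * mx_total F.
  pose V := [set x | exists t, x = mnorm (Y1 t)].
  have hV : has_sup V.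
    split; first by exists (mnorm (Y1 0)), 0.
    have [_ [M YM]] := mx_bounded_measurable_norm hY1.
    by exists M => _ [s ->]; exact: le_trans (ler_norm _) (YM s).
  have Ysup s : mnorm (Y1 s) <= sup V by apply: ub_le_sup; [exact: hV.2|exists s].
  have : sup V <= K * mx_total F + sup V / 2.
    by apply: ge_sup; [exact: hV.1|move=> _ [s ->]; exact: step].
  have := Ysup t; lra.
split => // Y [[y0 solY] bc] t.
have [[y1 solY1] bc1] := sol0.
have hFD : mx_integrable (fun t => F t + (A1 t - A t) *m Y1 t) by exact: mx_integrableD.
have solW := solvesB hA hFD hF solY1 solY.
have solW' : solves_bvp A al be (fun t => (A1 t - A t) *m Y1 t) (- g) (fun t => Y1 t - Y t).
  split.
    exists (y1 - y0); move: solW; under [X in solves A X]eq_fun do rewrite addrAC subrr add0r.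
    by [].
  by rewrite !mulmxBr addrACA -opprD bc bc1 subr0.
have := HK _ _ _ hDY sDY solW' t => /le_trans; apply.
rewrite mnormN; have h1 := ler_wpM2l (ltW K0) (small _ bound).
apply: (le_trans h1); lra.
Qed.

(** The bound for [Y1] with zero source says that the perturbed homogeneous problem has only the
    zero solution. *)
Lemma nondegenerate_perturbation A al be : mx_integrable A -> supported a b A ->
  nondegenerate A al be -> exists2 K : R, 0 < K & forall A1 al1 be1 (d : R),
    mx_integrable A1 -> supported a b A1 -> K * d <= 2^-1 ->
    mx_total (fun t => A1 t - A t) + mnorm (al1 - al) + mnorm (be1 - be) <= d ->
    nondegenerate A1 al1 be1 /\
    forall F Y1, mx_integrable F -> supported a b F -> solves_bvp A1 al1 be1 F 0 Y1 ->
      (forall t, mnorm (Y1 t) <= 2 * K * mx_total F) /\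
      (forall Y, solves_bvp A al be F 0 Y ->
        forall t, mnorm (Y1 t - Y t) <= 2 * K ^+ 2 * d * mx_total F).
Proof.
move=> hA sA nd; have [K K0 HK] := bvp_perturbation hA sA nd; exists K => //.
move=> A1 al1 be1 d hA1 sA1 Kd dE; split; last exact: HK.
move=> Y solY t; have s0 : supported a b (fun=> 0 : 'cV[R]_m) by [].
have [/(_ t) h _] := HK _ _ _ _ hA1 sA1 Kd dE _ _ (@mx_integrable0 _ m 1) s0 solY.
apply: mnorm_le0; apply: (le_trans h); rewrite /mx_total /total_norm.
rewrite (_ : (fun x => _) = cst 0); first by rewrite Rintegral_cst//= mul0r mulr0.
by apply/funext => x; rewrite mnorm0 normr0.
Qed.

End BoundaryValueProblem.

(** * Complex functions on the interval and their L_1 and L_2 norms *)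

Section ComplexFunctions.
Context {R : realType} (a b : R) (ab : a < b).
Local Notation mu := (@lebesgue_measure R).
Local Notation normc := (@Normc.normc R).
Implicit Types f g : R -> R[i].

Lemma normc_ge0 (z : R[i]) : 0 <= normc z.
Proof. by case: z => x y; exact: sqrtr_ge0. Qed.

Lemma normc_ge_Re (z : R[i]) : `|complex.Re z| <= normc z.
Proof.
case: z => x y /=; rewrite -sqrtr_sqr ler_wsqrtr//.
by rewrite lerDl sqr_ge0.
Qed.

Lemma normc_ge_Im (z : R[i]) : `|complex.Im z| <= normc z.
Proof.
case: z => x y /=; rewrite -sqrtr_sqr ler_wsqrtr//.
by rewrite lerDr sqr_ge0.
Qed.

Lemma normc_le_ReIm (z : R[i]) : normc z <= `|complex.Re z| + `|complex.Im z|.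
Proof.
case: z => x y /=; rewrite -[leRHS]ger0_norm ?addr_ge0// -sqrtr_sqr ler_wsqrtr//.
rewrite sqrrD !real_normK ?num_real// addrAC lerDl.
by rewrite mulrn_wge0// mulr_ge0.
Qed.

Lemma ReD (x y : R[i]) : complex.Re (x + y) = complex.Re x + complex.Re y.
Proof. by case: x; case: y. Qed.

Lemma ImD (x y : R[i]) : complex.Im (x + y) = complex.Im x + complex.Im y.
Proof. by case: x; case: y. Qed.

Lemma ReN (x : R[i]) : complex.Re (- x) = - complex.Re x.
Proof. by case: x. Qed.

Lemma ImN (x : R[i]) : complex.Im (- x) = - complex.Im x.
Proof. by case: x. Qed.

Lemma ReM (x y : R[i]) :
  complex.Re (x * y) = complex.Re x * complex.Re y - complex.Im x * complex.Im y.
Proof. by case: x; case: y. Qed.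

Lemma ImM (x y : R[i]) :
  complex.Im (x * y) = complex.Re x * complex.Im y + complex.Im x * complex.Re y.
Proof. by case: x => ? ?; case: y => ? ?. Qed.

(** The target is a general [nmodType] because real, complex and matrix-valued functions are all
    extended by zero. *)
Definition cut (V : nmodType) (f : R -> V) (t : R) : V :=
  if t \in `]a, b[ then f t else 0.

Lemma cut_in (V : nmodType) (f : R -> V) t : `]a, b[%classic t -> cut f t = f t.
Proof. by move=> tab; rewrite /cut (_ : t \in _ = true). Qed.

Lemma cut_out (V : nmodType) (f : R -> V) t : ~ `]a, b[%classic t -> cut f t = 0.
Proof. by move=> /negP tab; rewrite /cut (negbTE tab). Qed.

Lemma cut_patch (u : R -> R) : cut u = u \_ `]a, b[%classic.
Proof.
apply/funext => t; rewrite patchE /cut mem_setE.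
by case: ifP.
Qed.

Lemma measurable_cut (u : R -> R) :
  measurable_fun `]a, b[%classic u -> measurable_fun setT (cut u).
Proof. by rewrite cut_patch => mu_; apply/(measurable_restrictT _ _).1. Qed.

Lemma Re_cut f t : complex.Re (cut f t) = cut (fun t => complex.Re (f t)) t.
Proof. by rewrite /cut; case: ifP. Qed.

Lemma Im_cut f t : complex.Im (cut f t) = cut (fun t => complex.Im (f t)) t.
Proof. by rewrite /cut; case: ifP. Qed.

Lemma normc_cut f t : normc (cut f t) = cut (fun t => normc (f t)) t.
Proof. by rewrite /cut; case: ifP => // _; rewrite Normc.normc0. Qed.

Lemma measurableJ_normc f : measurableJ a b f ->
  measurable_fun setT (fun t => normc (cut f t)).
Proof.
move=> [/measurable_cut mre /measurable_cut mim].
have -> : (fun t => normc (cut f t)) = (fun t => Num.sqrt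
    (cut (fun t => complex.Re (f t)) t ^+ 2 + cut (fun t => complex.Im (f t)) t ^+ 2)).
  by apply/funext => t; rewrite -Re_cut -Im_cut; case: (cut f t).
apply: (@measurableT_comp _ _ _ _ _ _ (@Num.sqrt R)).
  by apply: continuous_measurable_fun; exact: sqrt_continuous.
by apply: measurable_funD; exact: measurable_funX.
Qed.

Lemma normLpE (p : R) f :
  normLp a b p f = Lnorm mu p%:E (fun t => (normc (cut f t))%:E).
Proof.
rewrite /normLp; congr (Lnorm _ _ _); apply/funext => t.
by rewrite patchE mem_setE normc_cut /cut; case: ifP.
Qed.

Lemma normLp_ge0 (p : R) f : (0 <= normLp a b p f)%E.
Proof. exact: Lnorm_ge0. Qed.

Lemma inLp1_integrable f : inLp a b 1 f -> real_integrable (fun t => normc (cut f t)).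
Proof.
move=> [/measurableJ_normc mf]; rewrite normLpE Lnorm1 => fin.
by apply/integrableP; split; first exact/measurable_EFinP.
Qed.

Lemma normLp1E f : inLp a b 1 f ->
  normLp a b 1 f = (total_norm (fun t => normc (cut f t)))%:E.
Proof.
move=> /inLp1_integrable hf; rewrite normLpE Lnorm1 /total_norm /Rintegral fineK//.
by apply: integrable_fin_num => //; exact: real_integrable_norm.
Qed.

Lemma inLp2P f : inLp a b 2 f <->
  measurableJ a b f /\ real_integrable (fun t => normc (cut f t) ^+ 2).
Proof.
have E t : `|normc (cut f t)| `^ 2 = normc (cut f t) ^+ 2.
  by rewrite powR_mulrn// ger0_norm ?normc_ge0.
split => -[mf].
  rewrite normLpE unlock /=; under eq_integral do rewrite E.
  move=> /lty_poweRy => /(_ (invr_neq0 _)) fin; split => //.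
  apply/integrableP; split.
    by apply/measurable_EFinP; apply: measurable_funX; exact: measurableJ_normc.
  under eq_integral do rewrite /= ger0_norm ?sqr_ge0//.
  exact: fin.
move=> /integrableP[_]; under eq_integral do rewrite /= ger0_norm ?sqr_ge0//.
move=> fin; split => //; rewrite normLpE unlock /=.
by under eq_integral do rewrite E; exact: poweR_lty.
Qed.

Lemma normLp2E f : inLp a b 2 f ->
  normLp a b 2 f = (Num.sqrt (\int[mu]_x (normc (cut f x) ^+ 2)))%:E.
Proof.
move=> /inLp2P[mf hf]; rewrite normLpE unlock /=.
under eq_integral do rewrite powR_mulrn// ger0_norm ?normc_ge0//.
rewrite -powR12_sqrt; last by apply: Rintegral_ge0 => x _; exact: sqr_ge0.
by rewrite -poweR_EFin /Rintegral fineK//; exact: integrable_fin_num.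
Qed.

Lemma real_integrable_cut_cst (c : R) : real_integrable (cut (fun=> c)).
Proof.
have -> : cut (fun=> c) = (fun t => c * \1_(`]a, b[%classic) t).
  apply/funext => t; rewrite indicE mem_setE /cut.
  by case: ifP; rewrite ?mulr1 ?mulr0.
exact/real_integrableZ/integrable_indic_itv.
Qed.

Lemma Rintegral_cut_cst (c : R) : \int[mu]_x (cut (fun=> c) x) = c * (b - a).
Proof.
have muJ : mu `]a, b[%classic = (b - a)%:E by rewrite lebesgue_measure_itv/= lte_fin ab.
by rewrite cut_patch -Rintegral_mkcond Rintegral_cst// -[RHS]/(c * fine (b - a)%:E) -muJ.
Qed.

Lemma inLp2_of_bounded f S : measurableJ a b f -> 0 <= S ->
  (forall t, `]a, b[%classic t -> normc (f t) <= S) ->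
  inLp a b 2 f /\ (normLp a b 2 f <= (S * Num.sqrt (b - a))%:E)%E.
Proof.
move=> mf S0 fS.
have le t : normc (cut f t) ^+ 2 <= cut (fun=> S ^+ 2) t.
  have [tab|tab] := pselect (`]a, b[%classic t).
    by rewrite !cut_in// ler_sqr ?nnegrE ?normc_ge0//; exact: fS.
  by rewrite !cut_out// Normc.normc0 expr0n.
have hf : real_integrable (fun t => normc (cut f t) ^+ 2).
  apply: real_integrable_le (real_integrable_cut_cst (S ^+ 2)).
    by apply: measurable_funX; exact: measurableJ_normc.
  by move=> t; rewrite ger0_norm ?sqr_ge0.
have f2 : inLp a b 2 f by apply/inLp2P.
split => //; rewrite normLp2E// lee_fin.
rewrite -[X in X * _](ger0_norm S0) -sqrtr_sqr -sqrtrM ?sqr_ge0//; apply: ler_wsqrtr.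
rewrite -Rintegral_cut_cst; apply: le_Rintegral => //.
exact: real_integrable_cut_cst.
Qed.

Lemma inLp2_integrable f : inLp a b 2 f -> real_integrable (fun t => normc (cut f t)).
Proof.
move=> /inLp2P[mf hf].
apply: (real_integrable_le _ _ (real_integrableD (real_integrable_cut_cst 1) hf)).
  exact: measurableJ_normc.
move=> t; rewrite ger0_norm ?normc_ge0//.
have [tab|tab] := pselect (`]a, b[%classic t).
  (* On the finite interval, [x <= 1 + x ^+ 2] makes the L_2 function integrable. *)
  rewrite !cut_in//; have := sqr_ge0 (normc (f t) - 1).
  by rewrite sqrrB mulr1 expr1n; have := normc_ge0 (f t); lra.
by rewrite !cut_out// Normc.normc0 expr0n addr0.
Qed.

(* Cauchy-Schwarz against the constant 1. *)
Lemma total_norm_le_normLp2 f : inLp a b 2 f ->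
  ((total_norm (fun t => normc (cut f t)))%:E <= (Num.sqrt (b - a))%:E * normLp a b 2 f)%E.
Proof.
move=> f2; have h1 := inLp2_integrable f2; have [mf h2] := (inLp2P f).1 f2.
have L0 : 0 < b - a by rewrite subr_gt0.
rewrite normLp2E// -EFinM lee_fin -(sqrtrM _ (ltW L0)).
set I2 := \int[mu]_x _; set I1 := total_norm _.
have I10 : 0 <= I1 by exact: total_norm_ge0.
rewrite -[I1]ger0_norm// -sqrtr_sqr ler_wsqrtr//.
have I1E : I1 = \int[mu]_x normc (cut f x).
  by apply: eq_Rintegral => x _; rewrite ger0_norm ?normc_ge0.
(* [l] is the mean of [|f|]; expanding the nonnegative integral of [(|f| - l) ^+ 2] over the
   interval gives [l * I1 <= I2]. *)
pose l := I1 / (b - a).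
have h3 : real_integrable (fun t => normc (cut f t) ^+ 2 + (- (2 * l)) * normc (cut f t)).
  by apply: real_integrableD => //; exact: real_integrableZ.
have key : 0 <= I2 - 2 * l * I1 + l ^+ 2 * (b - a).
  have -> : I2 - 2 * l * I1 + l ^+ 2 * (b - a) = \int[mu]_x
      (normc (cut f x) ^+ 2 + (- (2 * l)) * normc (cut f x) + cut (fun=> l ^+ 2) x).
    rewrite RintegralD//; last exact: real_integrable_cut_cst.
    rewrite RintegralD//; last exact: real_integrableZ.
    by rewrite RintegralZl// -I1E Rintegral_cut_cst mulNr.
  apply: Rintegral_ge0 => t _.
  have [tab|tab] := pselect (`]a, b[%classic t).
    rewrite !cut_in//; have := sqr_ge0 (normc (f t) - l); rewrite sqrrB; lra.
  by rewrite !cut_out// Normc.normc0 expr0n mulr0 !addr0.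
have lE : l * (b - a) = I1 by rewrite /l divfK// gt_eqF.
have e2 : l ^+ 2 * (b - a) = l * I1 by rewrite -lE; ring.
have key2 : l * I1 <= I2 by lra.
rewrite (_ : I1 ^+ 2 = (b - a) * (l * I1)); last by rewrite mulrA [(b - a) * l]mulrC lE expr2.
by apply: ler_wpM2l => //; exact: ltW.
Qed.

Lemma measurableJD f g : measurableJ a b f -> measurableJ a b g ->
  measurableJ a b (fun t => f t + g t).
Proof.
move=> [mf1 mf2] [mg1 mg2]; split.
  rewrite (_ : (fun t => complex.Re _) = (fun t => complex.Re (f t) + complex.Re (g t))).
    exact: measurable_funD.
  by apply/funext => t; exact: ReD.
rewrite (_ : (fun t => complex.Im _) = (fun t => complex.Im (f t) + complex.Im (g t))).
  exact: measurable_funD.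
by apply/funext => t; exact: ImD.
Qed.

Lemma measurableJZ (c : R[i]) f : measurableJ a b f -> measurableJ a b (fun t => c * f t).
Proof.
move=> [mf1 mf2]; split.
  rewrite (_ : (fun t => complex.Re _) = (fun t =>
      complex.Re c * complex.Re (f t) - complex.Im c * complex.Im (f t))).
    by apply: measurable_funB; exact: measurable_funM.
  by apply/funext => t; exact: ReM.
rewrite (_ : (fun t => complex.Im _) = (fun t =>
    complex.Re c * complex.Im (f t) + complex.Im c * complex.Re (f t))).
  by apply: measurable_funD; exact: measurable_funM.
by apply/funext => t; exact: ImM.
Qed.

Lemma inLp2D f g : inLp a b 2 f -> inLp a b 2 g -> inLp a b 2 (fun t => f t + g t).
Proof.
move=> /inLp2P[mf hf] /inLp2P[mg hg]; have mfg := measurableJD mf mg.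
apply/inLp2P; split => //.
apply: (real_integrable_le _ _ (real_integrableZ 2 (real_integrableD hf hg))).
  by apply: measurable_funX; exact: measurableJ_normc.
move=> t; rewrite ger0_norm ?sqr_ge0//.
have -> : cut (fun t => f t + g t) t = cut f t + cut g t.
  by rewrite /cut; case: ifP; rewrite ?addr0.
have h1 : normc (cut f t + cut g t) <= normc (cut f t) + normc (cut g t).
  exact: le_normcD.
apply: (@le_trans _ _ ((normc (cut f t) + normc (cut g t)) ^+ 2)).
  by rewrite ler_sqr ?nnegrE ?addr_ge0 ?normc_ge0.
have := sqr_ge0 (normc (cut f t) - normc (cut g t)); rewrite sqrrB sqrrD; lra.
Qed.

Lemma inLp2Z (c : R[i]) f : inLp a b 2 f -> inLp a b 2 (fun t => c * f t).
Proof.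
move=> /inLp2P[mf hf]; have mcf := measurableJZ c mf.
apply/inLp2P; split => //.
apply: (real_integrable_le _ _ (real_integrableZ (normc c ^+ 2) hf)).
  by apply: measurable_funX; exact: measurableJ_normc.
move=> t; rewrite ger0_norm ?sqr_ge0//.
have -> : cut (fun t => c * f t) t = c * cut f t.
  by rewrite /cut; case: ifP; rewrite ?mulr0.
by rewrite Normc.normcM exprMn.
Qed.

End ComplexFunctions.

(** * Complex vectors and matrices as real ones of twice the size *)

Section Realification.
Context {R : realType}.
Local Notation normc := (@Normc.normc R).

Definition rvec n (v : 'cV[R[i]]_n) : 'cV[R]_(n + n) :=
  col_mx (map_mx (@complex.Re R) v) (map_mx (@complex.Im R) v).

Definition cvec n (w : 'cV[R]_(n + n)) : 'cV[R[i]]_n :=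
  \col_j (w (lshift n j) 0 +i* w (rshift n j) 0)%C.

Definition rmx m n (M : 'M[R[i]]_(m, n)) : 'M[R]_(m + m, n + n) :=
  block_mx (map_mx (@complex.Re R) M) (- map_mx (@complex.Im R) M)
           (map_mx (@complex.Im R) M) (map_mx (@complex.Re R) M).

Lemma rvec_lshift n (v : 'cV[R[i]]_n) j : rvec v (lshift n j) 0 = complex.Re (v j 0).
Proof. by rewrite col_mxEu mxE. Qed.

Lemma rvec_rshift n (v : 'cV[R[i]]_n) j : rvec v (rshift n j) 0 = complex.Im (v j 0).
Proof. by rewrite col_mxEd mxE. Qed.

Lemma rvecK n (w : 'cV[R]_(n + n)) : rvec (cvec w) = w.
Proof.
apply/matrixP => i j; rewrite (ord1 j); case: (split_ordP i) => k ->.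
  by rewrite rvec_lshift mxE.
by rewrite rvec_rshift mxE.
Qed.

Lemma cvecK n (v : 'cV[R[i]]_n) : cvec (rvec v) = v.
Proof.
apply/matrixP => i j; rewrite (ord1 j) mxE rvec_lshift rvec_rshift.
by case: (v i 0).
Qed.

Lemma Re_sum (I : Type) (r : seq I) (F : I -> R[i]) :
  complex.Re (\sum_(i <- r) F i) = \sum_(i <- r) complex.Re (F i).
Proof. by elim: r => [|i r IH]; rewrite ?big_nil// !big_cons -IH; exact: ReD. Qed.

Lemma Im_sum (I : Type) (r : seq I) (F : I -> R[i]) :
  complex.Im (\sum_(i <- r) F i) = \sum_(i <- r) complex.Im (F i).
Proof. by elim: r => [|i r IH]; rewrite ?big_nil// !big_cons -IH; exact: ImD. Qed.

Lemma rmxM m n (M : 'M[R[i]]_(m, n)) (v : 'cV[R[i]]_n) :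
  rmx M *m rvec v = rvec (M *m v).
Proof.
rewrite /rmx /rvec mul_block_col; congr col_mx; apply/matrixP => i j; rewrite !mxE.
  by rewrite Re_sum -big_split; apply: eq_bigr => k _; rewrite !mxE mulNr; exact: esym (ReM _ _).
rewrite Im_sum -big_split; apply: eq_bigr => k _; rewrite !mxE /= addrC.
exact: esym (ImM _ _).
Qed.

Lemma rvecD n (v w : 'cV[R[i]]_n) : rvec (v + w) = rvec v + rvec w.
Proof.
rewrite /rvec add_col_mx; congr col_mx; apply/matrixP => i j; rewrite !mxE.
  exact: ReD.
exact: ImD.
Qed.

Lemma rvec0 n : rvec (0 : 'cV[R[i]]_n) = 0.
Proof. by apply: (addrI (rvec 0)); rewrite -rvecD !addr0. Qed.

Lemma rmxB m n (M N : 'M[R[i]]_(m, n)) : rmx (M - N) = rmx M - rmx N.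
Proof.
rewrite /rmx opp_block_mx add_block_mx; congr block_mx;
  by apply/matrixP => i j; rewrite !mxE; case: (M i j) => ? ?; case: (N i j) => ? ? //=; ring.
Qed.

Lemma mnorm_col_mx m1 m2 n (A : 'M[R]_(m1, n)) (B : 'M[R]_(m2, n)) :
  mnorm (col_mx A B) = mnorm A + mnorm B.
Proof.
rewrite /mnorm big_split_ord; congr (_ + _); apply: eq_bigr => i _;
  by apply: eq_bigr => j _; rewrite ?col_mxEu ?col_mxEd.
Qed.

Lemma mnorm_row_mx m n1 n2 (A : 'M[R]_(m, n1)) (B : 'M[R]_(m, n2)) :
  mnorm (row_mx A B) = mnorm A + mnorm B.
Proof.
rewrite /mnorm -big_split; apply: eq_bigr => i _; rewrite big_split_ord.
congr (_ + _); by apply: eq_bigr => j _; rewrite ?row_mxEl ?row_mxEr.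
Qed.

Definition cmnorm m n (M : 'M[R[i]]_(m, n)) : R := \sum_i \sum_j normc (M i j).

Lemma mnorm_Re m n (M : 'M[R[i]]_(m, n)) : mnorm (map_mx (@complex.Re R) M) <= cmnorm M.
Proof. by apply: ler_sum => i _; apply: ler_sum => j _; rewrite mxE normc_ge_Re. Qed.

Lemma mnorm_Im m n (M : 'M[R[i]]_(m, n)) : mnorm (map_mx (@complex.Im R) M) <= cmnorm M.
Proof. by apply: ler_sum => i _; apply: ler_sum => j _; rewrite mxE normc_ge_Im. Qed.

Lemma mnorm_rvec n (v : 'cV[R[i]]_n) : mnorm (rvec v) <= 2 * cmnorm v.
Proof.
by rewrite mnorm_col_mx; have := mnorm_Re v; have := mnorm_Im v; lra.
Qed.

Lemma mnorm_rmx m n (M : 'M[R[i]]_(m, n)) : mnorm (rmx M) <= 4 * cmnorm M.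
Proof.
rewrite /rmx /block_mx mnorm_col_mx !mnorm_row_mx mnormN.
by have := mnorm_Re M; have := mnorm_Im M; lra.
Qed.

Lemma normc_cvec n (w : 'cV[R]_(n + n)) j : normc (cvec w j 0) <= mnorm w.
Proof.
rewrite -[in leRHS](rvecK w) mnorm_col_mx; apply: (le_trans (normc_le_ReIm _)).
apply: lerD.
  by have := mnorm_entry (map_mx (@complex.Re R) (cvec w)) j 0; rewrite mxE.
by have := mnorm_entry (map_mx (@complex.Im R) (cvec w)) j 0; rewrite mxE.
Qed.

Lemma mx_integrable_col_mx m1 m2 n (A : R -> 'M[R]_(m1, n)) (B : R -> 'M[R]_(m2, n)) :
  mx_integrable A -> mx_integrable B -> mx_integrable (fun t => col_mx (A t) (B t)).
Proof.
move=> hA hB i j; case: (split_ordP i) => k ->.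
  by under eq_fun do rewrite col_mxEu.
by under eq_fun do rewrite col_mxEd.
Qed.

Lemma mx_integrable_row_mx m n1 n2 (A : R -> 'M[R]_(m, n1)) (B : R -> 'M[R]_(m, n2)) :
  mx_integrable A -> mx_integrable B -> mx_integrable (fun t => row_mx (A t) (B t)).
Proof.
move=> hA hB i j; case: (split_ordP j) => k ->.
  by under eq_fun do rewrite row_mxEl.
by under eq_fun do rewrite row_mxEr.
Qed.

Section Integrable.
Variables (m n : nat) (M : R -> 'M[R[i]]_(m, n)).
Hypothesis hRe : forall i j, real_integrable (fun t => complex.Re (M t i j)).
Hypothesis hIm : forall i j, real_integrable (fun t => complex.Im (M t i j)).

Let iRe : mx_integrable (fun t => map_mx (@complex.Re R) (M t)).
Proof. by move=> i j; under eq_fun do rewrite mxE. Qed.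

Let iIm : mx_integrable (fun t => map_mx (@complex.Im R) (M t)).
Proof. by move=> i j; under eq_fun do rewrite mxE. Qed.

Lemma mx_integrable_rmx : mx_integrable (fun t => rmx (M t)).
Proof.
apply: mx_integrable_col_mx; apply: mx_integrable_row_mx => //.
move=> i j; under eq_fun do rewrite mxE -mulN1r.
exact: real_integrableZ.
Qed.

End Integrable.

Lemma mx_integrable_rvec n (v : R -> 'cV[R[i]]_n) :
  (forall i, real_integrable (fun t => complex.Re (v t i 0))) ->
  (forall i, real_integrable (fun t => complex.Im (v t i 0))) ->
  mx_integrable (fun t => rvec (v t)).
Proof.
move=> hRe hIm; apply: mx_integrable_col_mx => i j; rewrite (ord1 j).
  by under eq_fun do rewrite mxE.
by under eq_fun do rewrite mxE.
Qed.

End Realification.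

(** * Integral equation versus derivatives almost everywhere *)

Section AbsolutelyContinuousSolutions.
Context {R : realType} (a b : R) (ab : a < b).
Local Notation mu := (@lebesgue_measure R).

Lemma absolutely_continuousP (f : R -> R[i]) : absolutely_continuous a b f <->
  real_ac a b (fun t => complex.Re (f t)) /\ real_ac a b (fun t => complex.Im (f t)).
Proof.
have ReB x y : complex.Re (f x - f y) = complex.Re (f x) - complex.Re (f y).
  by case: (f x) => ? ?; case: (f y).
have ImB x y : complex.Im (f x - f y) = complex.Im (f x) - complex.Im (f y).
  by case: (f x) => ? ?; case: (f y).
split=> [acf|[acr aci] e e0].
  by split=> e /acf[d d0 H]; exists d => // n s t st tr /(H _ _ _ st tr);
    apply: le_lt_trans; apply: ler_sum => i _;
    rewrite -?ReB -?ImB ?normc_ge_Re ?normc_ge_Im.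
have e20 : 0 < e / 2 by rewrite divr_gt0.
have [d d0 H] := acr _ e20; have [d' d'0 H'] := aci _ e20.
exists (Num.min d d') => [|n s t st tr]; first by rewrite lt_min d0.
rewrite lt_min => /andP[/(H _ _ _ st tr) h /(H' _ _ _ st tr) h'].
apply: (@le_lt_trans _ _ (\sum_(i < n) `|complex.Re (f (t i)) - complex.Re (f (s i))| +
    \sum_(i < n) `|complex.Im (f (t i)) - complex.Im (f (s i))|)); last by lra.
rewrite -big_split; apply: ler_sum => i _ /=.
by rewrite -ReB -ImB; exact: normc_le_ReIm.
Qed.

(** A function in the domain of the operator is arbitrary off [[a, b]]. Composing it with this
    projection makes it bounded, measurable and constant on either side, as a solution of the
    integral equation on all of R must be. *)
Definition clamp (t : R) : R := Num.max a (Num.min t b).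

Lemma clamp_itv t : a <= clamp t <= b.
Proof. by rewrite /clamp le_max lexx/= ge_max (ltW ab) ge_min lexx orbT. Qed.

Lemma clampE t : a <= t <= b -> clamp t = t.
Proof. by move=> /andP[at_ tb]; rewrite /clamp (min_idPl tb) (max_idPr at_). Qed.

Lemma clamp_lipschitz s t : s <= t -> 0 <= clamp t - clamp s <= t - s.
Proof.
move=> st; rewrite /clamp.
case: (leP s b) => sb; case: (leP t b) => tb;
  case: (leP a s) => as_; case: (leP a t) => at_; case: (leP a b) => ab';
  apply/andP; split; lra.
Qed.

Lemma real_ac_dist (u : R -> R) : real_ac a b u -> forall e, 0 < e -> exists2 d : R, 0 < d &
  forall s t, a <= s -> s <= t -> t <= b -> t - s < d -> `|u t - u s| < e.
Proof.
move=> acu e e0; have [d d0 H] := acu _ e0; exists d => // s t as_ st tb td.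
have [->|s_t] := eqVneq s t; first by rewrite subrr normr0.
have := H 1%N (fun=> s) (fun=> t); rewrite !big_ord1; apply => //.
- by move=> _; split => //; rewrite lt_neqAle s_t.
- by move=> i j _ _ _; rewrite (ord1 i) (ord1 j).
Qed.

Lemma real_ac_clamp_continuous (u : R -> R) : real_ac a b u -> continuous (u \o clamp).
Proof.
move=> /real_ac_dist acu t; apply/cvgrPdist_lt => e /acu[d d0 H].
near=> s.
have ts : `|t - s| < d by near: s; apply: cvgr_dist_lt.
have [/andP[at_ tb] /andP[as_ sb]] := (clamp_itv t, clamp_itv s).
rewrite /=; have [st|/ltW st] := leP s t.
  have := clamp_lipschitz st; move: ts; rewrite ger0_norm ?subr_ge0// => ts /andP[h1 h2].
  by apply: H => //; lra.
have := clamp_lipschitz st; move: ts; rewrite distrC ger0_norm ?subr_ge0// => ts /andP[h1 h2].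
by rewrite distrC; apply: H => //; lra.
Unshelve. all: by end_near. Qed.

Lemma bounded_measurable_clamp (u : R -> R) : real_ac a b u ->
  bounded_measurable (u \o clamp).
Proof.
move=> acu; have cu := real_ac_clamp_continuous acu; split.
  exact: continuous_measurable_fun.
have cu' : {within `[a, b], continuous (fun t => `|(u \o clamp) t|)}.
  apply: continuous_subspaceT => t; apply: continuous_comp; first exact: cu.
  exact: norm_continuous.
have [c _ Hc] := EVT_max (ltW ab) cu'.
exists `|(u \o clamp) c| => t.
have := Hc (clamp t); rewrite in_itv /= clamp_itv clampE ?clamp_itv//.
by apply.
Qed.

(** Inside [[a, b]] this is [real_ac_FTC]; outside, both sides are constant. *)
Lemma real_ac_clamp_indef (u g : R -> R) : real_ac a b u -> real_integrable g ->
  (forall t, ~ `]a, b[%classic t -> g t = 0) ->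
  {ae mu, forall t, `]a, b[%classic t -> is_derive t 1 u (g t)} ->
  forall t, u (clamp t) = u a + indef g t.
Proof.
move=> acu hg sg du t.
have gl s : s <= a -> g s = 0.
  by move=> sa; apply: sg; rewrite /= in_itv/= => /andP[/lt_le_trans/(_ sa)]; rewrite ltxx.
have gr s : b < s -> g s = 0.
  by move=> bs; apply: sg; rewrite /= in_itv/= => /andP[_ /(lt_trans bs)]; rewrite ltxx.
have iga : indef g a = 0 by exact: (indef_left gl).
have main s : a <= s -> s <= b -> u s = u a + indef g s.
  move=> as_ sb; have := real_ac_FTC as_ (real_acS (lexx a) sb acu) hg; rewrite iga subr0.
  move=> <-; first by rewrite addrC subrK.
  apply: ae_imp du => x H xas; apply: H.
  by move: xas; rewrite /= !in_itv/= => /andP[-> /lt_le_trans->].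
have [ta|/ltW at_] := leP t a.
  rewrite (indef_left gl ta) addr0; congr u.
  by rewrite /clamp; apply/max_idPl; rewrite ge_min ta.
have [tb|/ltW bt] := leP t b; first by rewrite clampE ?at_ ?tb// main.
rewrite (indef_right hg gr bt) -main ?lexx ?ltW//; congr u.
by rewrite /clamp (min_idPr bt) (max_idPr (ltW ab)).
Qed.

Lemma ae_forall_ord m (P : 'I_m -> R -> Prop) :
  (forall i, {ae mu, forall t, P i t}) -> {ae mu, forall t, forall i, P i t}.
Proof.
move=> aeP; apply: (@filter_forall _ _ _ _ (ae_filter_ringOfSetsType mu)) => i.
exact: aeP.
Qed.

(** The passage from derivatives to the integral equation; [solves_real_ac] and [solves_derive] give
    the way back. *)
Lemma solves_of_derive m (A : R -> 'M[R]_m) (F u : R -> 'cV[R]_m) :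
  mx_integrable A -> supported a b A -> mx_integrable F -> supported a b F ->
  (forall i, real_ac a b (fun t => u t i 0)) ->
  {ae mu, forall t, `]a, b[%classic t ->
    forall i, is_derive t 1 (fun s => u s i 0) ((A t *m u t + F t) i 0)} ->
  solves A F (u a) (u \o clamp).
Proof.
move=> hA sA hF sF acu du.
have bmu : mx_bounded_measurable (u \o clamp).
  by move=> i j; rewrite (ord1 j); exact: (bounded_measurable_clamp (acu i)).
have hG : mx_integrable (fun t => A t *m (u \o clamp) t + F t).
  by apply: mx_integrableD => //; exact: mx_integrableM.
split=> // t; apply/matrixP => i j; rewrite (ord1 j) !mxE.
apply: (@real_ac_clamp_indef (fun t => u t i 0)) => //.
- by move=> s ns; rewrite sA// sF// mul0mx addr0 mxE.
- apply: ae_imp du => s H sab; have := H sab i; rewrite /= clampE//.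
  by move: sab; rewrite /= in_itv/= => /andP[/ltW-> /ltW->].
Qed.

Lemma solves_real_ac m (A : R -> 'M[R]_m) (F : R -> 'cV[R]_m) y0 Y :
  mx_integrable A -> mx_integrable F -> solves A F y0 Y ->
  forall i, real_ac a b (fun t => Y t i 0).
Proof.
move=> hA hF [hY eqY] i.
have hG : mx_integrable (fun t => A t *m Y t + F t).
  by apply: mx_integrableD => //; exact: mx_integrableM.
have acI := indef_real_ac a b (hG i 0).
apply: (real_ac_le2 _ _ acI acI (C := 1)) => // x y _ _.
rewrite mul1r (eqY x) (eqY y) !mxE.
by rewrite opprD addrACA subrr add0r lerDl.
Qed.

Lemma solves_derive m (A : R -> 'M[R]_m) (F : R -> 'cV[R]_m) y0 Y :
  mx_integrable A -> mx_integrable F -> solves A F y0 Y ->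
  {ae mu, forall t : R, forall i,
    is_derive t (1 : R) (fun s : R => Y s i 0) ((A t *m Y t + F t) i 0)}.
Proof.
move=> hA hF [hY eqY]; apply: ae_forall_ord => i.
have hG : mx_integrable (fun t => A t *m Y t + F t).
  by apply: mx_integrableD => //; exact: mx_integrableM.
apply: ae_imp (indef_derive (hG i 0)) => t dI.
have -> : (fun s => Y s i 0) =
    cst (y0 i 0) + indef (fun t => (A t *m Y t + F t) i 0).
  by apply/funext => s; rewrite eqY !mxE.
rewrite -[X in is_derive _ _ _ X]add0r; exact: is_deriveD.
Qed.

End AbsolutelyContinuousSolutions.

(** * The quasi-differential equation as a first-order system *)

Section SturmLiouvilleSystem.
Context {R : realType} (a b : R) (ab : a < b).
Local Notation normc := (@Normc.normc R).
Local Notation lebesgue := (@lebesgue_measure R).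
Local Notation cut := (cut a b).

Lemma inLp1P (f : R -> R[i]) : inLp a b 1 f <->
  measurableJ a b f /\ real_integrable (fun t => normc (cut f t)).
Proof.
split=> [hf|[mf hf]]; first by split; [case: hf|exact: inLp1_integrable].
split=> //; rewrite normLpE Lnorm1; move/integrableP : hf => [_].
by [].
Qed.

Lemma cutB (V : zmodType) (f g : R -> V) t : cut (fun t => f t - g t) t = cut f t - cut g t.
Proof. by rewrite /cut; case: ifP; rewrite ?subr0. Qed.

Lemma cutN (V : zmodType) (f : R -> V) t : cut (fun t => - f t) t = - cut f t.
Proof. by rewrite /cut; case: ifP; rewrite ?oppr0. Qed.

Lemma cut_mx m n (M : R -> 'M[R[i]]_(m, n)) t i j : cut M t i j = cut (fun t => M t i j) t.
Proof. by rewrite /cut; case: ifP; rewrite ?mxE. Qed.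

Lemma measurableJB (f g : R -> R[i]) : measurableJ a b f -> measurableJ a b g ->
  measurableJ a b (fun t => f t - g t).
Proof.
move=> mf /(measurableJZ (-1)) mg; have := measurableJD mf mg.
by under [X in measurableJ _ _ X]eq_fun do rewrite mulN1r.
Qed.

Lemma inLp1B (f g : R -> R[i]) : inLp a b 1 f -> inLp a b 1 g ->
  inLp a b 1 (fun t => f t - g t).
Proof.
move=> /inLp1P[mf hf] /inLp1P[mg hg]; have mfg := measurableJB mf mg.
apply/inLp1P; split => //.
apply: (real_integrable_le _ _ (real_integrableD hf hg)); first exact: measurableJ_normc.
move=> t; rewrite ger0_norm ?normc_ge0// cutB.
by rewrite -[normc (cut g t)]normcN; exact: le_normcD.
Qed.

Definition cut_integrable (f : R -> R[i]) : Prop :=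
  real_integrable (fun t => complex.Re (cut f t)) /\
  real_integrable (fun t => complex.Im (cut f t)).

Lemma cut_integrableP (f : R -> R[i]) : measurableJ a b f ->
  real_integrable (fun t => normc (cut f t)) -> cut_integrable f.
Proof.
move=> [mre mim] hf; split; apply: (real_integrable_le _ _ hf).
- by under eq_fun do rewrite Re_cut; exact: measurable_cut.
- by move=> t; exact: normc_ge_Re.
- by under eq_fun do rewrite Im_cut; exact: measurable_cut.
- by move=> t; exact: normc_ge_Im.
Qed.

Lemma cut_integrableN (f : R -> R[i]) : cut_integrable f -> cut_integrable (fun t => - f t).
Proof.
move=> [hr hi]; split.
  rewrite (_ : (fun t => _) = (fun t => -1 * complex.Re (cut f t))); first exact: real_integrableZ.
  by apply/funext => t; rewrite cutN mulN1r; exact: ReN.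
rewrite (_ : (fun t => _) = (fun t => -1 * complex.Im (cut f t))); first exact: real_integrableZ.
by apply/funext => t; rewrite cutN mulN1r; exact: ImN.
Qed.

Lemma cut_integrableB_cst (f : R -> R[i]) (c : R[i]) : cut_integrable f ->
  cut_integrable (fun t => f t - c).
Proof.
move=> [hr hi]; split.
  rewrite (_ : (fun t => _) = (fun t => complex.Re (cut f t) - cut (fun=> complex.Re c) t)).
    by apply: real_integrableB => //; exact: real_integrable_cut_cst.
  by apply/funext => t; rewrite cutB -Re_cut; case: (cut f t) => ? ?; case: (cut _ t).
rewrite (_ : (fun t => _) = (fun t => complex.Im (cut f t) - cut (fun=> complex.Im c) t)).
  by apply: real_integrableB => //; exact: real_integrable_cut_cst.
by apply/funext => t; rewrite cutB -Im_cut; case: (cut f t) => ? ?; case: (cut _ t).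
Qed.

Lemma has_deriv_rvec (v : R -> 'cV[R[i]]_2) (t : R) (w : 'cV[R[i]]_2) :
  (forall j, has_deriv (fun s => v s j 0) t (w j 0)) <->
  (forall i, is_derive t (1 : R) (fun s : R => rvec (v s) i 0) (rvec w i 0)).
Proof.
split=> [H i|H j].
  case: (split_ordP i) => j ->; have [dr di] := H j.
    by under eq_fun do rewrite rvec_lshift; rewrite rvec_lshift.
  by under eq_fun do rewrite rvec_rshift; rewrite rvec_rshift.
split; first by have := H (lshift 2 j); under eq_fun do rewrite rvec_lshift; rewrite rvec_lshift.
by have := H (rshift 2 j); under eq_fun do rewrite rvec_rshift; rewrite rvec_rshift.
Qed.

(* With D^[1] y = y1, the equation l[y] = mu y + f is the system
   y' = (Q/p) y + (1/p) y1,  y1' = (-Q^2/p - mu) y - (Q/p) y1 - f. *)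
Definition system_mx (p Q : R -> R[i]) (mu : R[i]) (t : R) : 'M[R[i]]_2 :=
  \matrix_(i, j) if i == 0 then if j == 0 then Q t / p t else (p t)^-1
                 else if j == 0 then - (Q t ^+ 2 / p t) - mu else - (Q t / p t).

Definition source (f : R -> R[i]) (t : R) : 'cV[R[i]]_2 :=
  \col_i if i == 0 then 0 else - f t.

Definition real_system p Q mu t := rmx (cut (system_mx p Q mu) t).

Definition real_source f t := rvec (cut (source f) t).

Lemma system_entry p Q mu f (y y1 : R -> R[i]) t j :
  (system_mx p Q mu t *m boundary_vector y y1 t + source f t) j 0 =
  if j == 0 then Q t / p t * y t + (p t)^-1 * y1 t
  else (- (Q t ^+ 2 / p t) - mu) * y t - Q t / p t * y1 t - f t.
Proof.
rewrite !mxE !big_ord_recl big_ord0 addr0 !mxE /=.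
by case: ifP => _ //=; rewrite ?addr0 ?mulNr.
Qed.

Lemma supported_real_system p Q mu : supported a b (real_system p Q mu).
Proof.
move=> t nt; rewrite /real_system cut_out//.
by apply: mnorm_le0; apply: (le_trans (mnorm_rmx _));
  rewrite /cmnorm big1 ?mulr0// => i _; rewrite big1// => j _; rewrite mxE Normc.normc0.
Qed.

Lemma supported_real_source f : supported a b (real_source f).
Proof. by move=> t nt; rewrite /real_source cut_out// rvec0. Qed.

Lemma mx_integrable_real_source f : inLp a b 2 f -> mx_integrable (real_source f).
Proof.
move=> f2; have [mf _] := f2.
have [hr hi] := cut_integrableN (cut_integrableP mf (inLp2_integrable f2)).
have c0 : cut_integrable (fun=> 0).
  by split; under eq_fun do rewrite /cut if_same /=; exact: real_integrable0.
have [h0r h0i] := c0.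
apply: mx_integrable_rvec => i; under eq_fun do rewrite cut_mx.
  by under eq_fun do (under [X in cut X]eq_fun do rewrite mxE); case: (i == 0).
by under eq_fun do (under [X in cut X]eq_fun do rewrite mxE); case: (i == 0).
Qed.

Lemma mx_total_real_source f : inLp a b 2 f ->
  mx_total (real_source f) <= 2 * total_norm (fun t => normc (cut f t)).
Proof.
move=> f2; have hf := inLp2_integrable f2.
rewrite /mx_total /total_norm -RintegralZl//; last exact: real_integrable_norm.
apply: le_Rintegral => //.
- exact/real_integrable_norm/mx_integrable_norm/mx_integrable_real_source.
- exact/real_integrableZ/real_integrable_norm.
- move=> t _; rewrite !ger0_norm ?mnorm_ge0 ?normc_ge0//.
  apply: (le_trans (mnorm_rvec _)); apply: ler_wpM2l => //.
  rewrite /cmnorm !big_ord_recl !big_ord0 !addr0 !cut_mx.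
  rewrite (_ : cut _ t = 0) ?Normc.normc0 ?add0r; last first.
    by rewrite /cut; case: ifP => //; rewrite mxE.
  rewrite (_ : cut _ t = - cut f t); last first.
    by rewrite /cut; case: ifP; rewrite ?mxE ?oppr0.
  by rewrite normcN.
Qed.

Lemma cvec_boundary_vector (Y : R -> 'cV[R]_(2 + 2)) t : cvec (Y t) =
  boundary_vector (fun s => cvec (Y s) 0 0) (fun s => cvec (Y s) 1 0) t.
Proof.
apply/matrixP => i j; rewrite (ord1 j) [RHS]mxE.
by case: eqP => [->//|/eqP i0]; congr (cvec _ _ _); case: i i0 => -[|[|//]] // h _; apply: val_inj.
Qed.

Section System.
Variables (p Q : R -> R[i]).
Hypotheses (Vp_L1 : inLp a b 1 (fun t => (p t)^-1))
  (Qp_L1 : inLp a b 1 (fun t => Q t / p t))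
  (Q2p_L1 : inLp a b 1 (fun t => Q t ^+ 2 / p t)).

Lemma mx_integrable_real_system mu : mx_integrable (real_system p Q mu).
Proof.
have cint f : inLp a b 1 f -> cut_integrable f.
  by move=> /inLp1P[]; exact: cut_integrableP.
have c1 := cint _ Vp_L1; have c2 := cint _ Qp_L1.
have c3 := cut_integrableN c2.
have c4 := cut_integrableB_cst mu (cut_integrableN (cint _ Q2p_L1)).
have H i j : cut_integrable (fun t => system_mx p Q mu t i j).
  under [X in cut_integrable X]eq_fun do rewrite mxE.
  by case: (i == 0); case: (j == 0).
apply: mx_integrable_rmx => i j; under eq_fun do rewrite cut_mx.
  exact: (H i j).1.
exact: (H i j).2.
Qed.

Hypothesis p_neq0 : aeJ a b (fun t => p t != 0).

(** The vector of [y] and its quasi-derivative, clamped to [[a, b]], is the solution; agreement with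
    [y] can be asked only on the interval. *)
Lemma solves_of_resolvent al be mu f y : inLp a b 2 f ->
  resolvent a b (sturm_liouville a b p Q al be) mu f y ->
  exists Y, solves_bvp a b (real_system p Q mu) (rmx al) (rmx be) (real_source f) 0 Y /\
    forall t, `]a, b[%classic t -> cvec (Y t) 0 0 = y t.
Proof.
move=> f2 [g [y1 [y2 [[_ [acy acy1] q1 q2 _] bc _ gy2]]] fg].
pose v t := boundary_vector y y1 t.
have dv : aeJ a b (fun t => forall j, has_deriv (fun s => v s j 0) t
    ((system_mx p Q mu t *m v t + source f t) j 0)).
  (* Five almost-everywhere facts on the interval are paired: both quasi-derivatives, [p != 0], and
     the two equations for [g]. Where they all hold, dividing [y1 = p y' - Q y] by [p] gives the
     first row of the system. *)
  apply: ae_imp2 (ae_imp2 (fun t (h1 : _ -> _) h2 ht => conj (h1 ht) (h2 ht)) q1 q2)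
    (ae_imp2 (fun t (h1 : _ -> _) h2 ht => conj (h1 ht) (h2 ht)) p_neq0
      (ae_imp2 (fun t (h1 : _ -> _) h2 ht => conj (h1 ht) (h2 ht)) gy2 fg)).
  move=> t h1 h2 tJ; have [[dy hdy y1E] [dy1 hdy1 y2E]] := h1 tJ.
  have [p0 [gE fE]] := h2 tJ.
  move=> j; rewrite system_entry; have [j0|j0] := boolP (j == 0).
    have -> : Q t / p t * y t + (p t)^-1 * y1 t = dy by rewrite y1E; field.
    by under [X in has_deriv X]eq_fun do rewrite mxE j0.
  have -> : (- (Q t ^+ 2 / p t) - mu) * y t - Q t / p t * y1 t - f t = dy1.
    have -> : dy1 = y2 t - Q t / p t * y1 t - Q t ^+ 2 / p t * y t by rewrite y2E; ring.
    by rewrite fE gE; ring.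
  by under [X in has_deriv X]eq_fun do rewrite mxE (negbTE j0).
have acv i : real_ac a b (fun t => rvec (v t) i 0).
  have [ry iy] := (absolutely_continuousP a b y).1 acy.
  have [ry1 iy1] := (absolutely_continuousP a b y1).1 acy1.
  case: (split_ordP i) => j ->.
    by under [X in real_ac _ _ X]eq_fun do rewrite rvec_lshift mxE; case: (j == 0).
  by under [X in real_ac _ _ X]eq_fun do rewrite rvec_rshift mxE; case: (j == 0).
have sol : solves (real_system p Q mu) (real_source f) (rvec (v a))
    ((fun t => rvec (v t)) \o clamp a b).
  apply: (solves_of_derive ab) => //.
  - exact: mx_integrable_real_system.
  - exact: supported_real_system.
  - exact: mx_integrable_real_source.
  - exact: supported_real_source.
  - apply: ae_imp dv => t /[swap] tJ /(_ tJ) /has_deriv_rvec.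
    by rewrite /real_system /real_source !cut_in// rmxM -rvecD.
exists ((fun t => rvec (v t)) \o clamp a b); split.
  split; first by exists (rvec (v a)).
  by rewrite /= !clampE ?lexx ?(ltW ab)// !rmxM -rvecD bc rvec0.
move=> t; rewrite /= in_itv/= => /andP[/ltW at_ /ltW tb].
by rewrite clampE ?at_ ?tb// cvecK mxE.
Qed.

Lemma solves_has_deriv mu f y0 Y : inLp a b 2 f ->
  solves (real_system p Q mu) (real_source f) y0 Y ->
  aeJ a b (fun t => forall j, has_deriv (fun s => cvec (Y s) j 0) t
    ((system_mx p Q mu t *m cvec (Y t) + source f t) j 0)).
Proof.
move=> f2 sol; have hA := mx_integrable_real_system mu.
apply: ae_imp (solves_derive hA (mx_integrable_real_source f2) sol) => t H tJ.
apply/has_deriv_rvec => i; have := H i.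
rewrite /real_system /real_source !cut_in// -[Y t in X in is_derive _ _ _ X](rvecK (Y t)).
rewrite rmxM -rvecD.
by under eq_fun do rewrite -(rvecK (Y _)).
Qed.

Lemma resolvent_of_solves al be mu f Y : inLp a b 2 f ->
  solves_bvp a b (real_system p Q mu) (rmx al) (rmx be) (real_source f) 0 Y ->
  inLp a b 2 (fun t => cvec (Y t) 0 0) /\
  resolvent a b (sturm_liouville a b p Q al be) mu f (fun t => cvec (Y t) 0 0).
Proof.
move=> f2 [[y0 sol] bc].
have hA := mx_integrable_real_system mu; have hF := mx_integrable_real_source f2.
pose y t := cvec (Y t) 0 0; pose y1 t := cvec (Y t) 1 0.
have vE t : cvec (Y t) = boundary_vector y y1 t := cvec_boundary_vector Y t.
have bmY := mx_bounded_measurable_norm sol.1.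
have y_L2 : inLp a b 2 y.
  have [_ [M YM]] := bmY.
  have M0 : 0 <= M := le_trans (normr_ge0 _) (YM 0).
  apply: (inLp2_of_bounded ab _ M0 _).1.
    split; apply: measurable_funTS; rewrite /y; under eq_fun do rewrite mxE /=.
      exact: (sol.1 _ _).1.
    exact: (sol.1 _ _).1.
  by move=> t _; apply: le_trans (normc_cvec _ _) (le_trans (ler_norm _) (YM t)).
(* [g] is the value of the operator at [y], so the second quasi-derivative is [- g]; it is in L_2
   because [f] is and the solution [y] is bounded. *)
split=> //; pose g t := f t + mu * y t.
have g2 : inLp a b 2 g by apply: inLp2D => //; exact: inLp2Z.
have ng2 : inLp a b 2 (fun t => - g t).
  by have := inLp2Z (-1) g2; under [X in inLp _ _ _ X]eq_fun do rewrite mulN1r.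
have dY := solves_has_deriv f2 sol.
have acY := solves_real_ac a b hA hF sol.
exists g; last first.
  by apply: aeW => t _; rewrite /g addrK.
exists y1, (fun t => - g t); split => //.
- split => //.
  + split; apply/absolutely_continuousP; split; rewrite /y /y1;
      under [X in real_ac _ _ X]eq_fun do rewrite mxE /=; exact: acY.
  + apply: ae_imp2 dY p_neq0 => t H pn tJ; have hd := H tJ 0.
    rewrite vE system_entry eqxx in hd; exists (Q t / p t * y t + (p t)^-1 * y1 t) => //.
    by have p0 := pn tJ; rewrite -/(y t); field.
  + apply: ae_imp dY => t H tJ; have hd := H tJ 1.
    rewrite vE system_entry /= in hd.
    exists ((- (Q t ^+ 2 / p t) - mu) * y t - Q t / p t * y1 t - f t) => //.
    by rewrite -/(y t) /g; ring.
- rewrite -!vE -[LHS]cvecK -[RHS]cvecK; congr cvec.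
  by rewrite rvecD -!rmxM !rvecK bc rvec0.
- by apply: aeW => t _; rewrite opprK.
Qed.

End System.
End SturmLiouvilleSystem.

(** * From the resolvent set to nondegeneracy of the boundary value problem *)

Section Perturbation.
Context {R : realType} (a b : R) (ab : a < b).
Local Notation normc := (@Normc.normc R).
Local Notation lebesgue := (@lebesgue_measure R).


Lemma ae_meets (P : R -> Prop) (s t : R) : s < t ->
  {ae lebesgue, forall x, P x} -> exists2 x, s < x < t & P x.
Proof.
move=> st [N [mN N0 PN]]; apply: contrapT => noP.
have sub : `]s, t[%classic `<=` N.
  move=> x /=; rewrite in_itv/= => xst; apply: PN => /= Px.
  by apply: noP; exists x.
have : (lebesgue `]s, t[%classic <= lebesgue N)%E.
  by apply: le_measure => //; rewrite inE.
have -> : lebesgue N = 0%E by [].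
by rewrite lebesgue_measure_itv/= lte_fin st lee_fin subr_le0 leNgt st.
Qed.

(** Zeros of [u] exist arbitrarily close to [t] on its right. The approach from the right includes
    the end [a], whose value is the one needed later, and leaves out [b]. *)
Lemma real_ac_ae0 (u : R -> R) : real_ac a b u -> aeJ a b (fun t => u t = 0) ->
  forall t, a <= t < b -> u t = 0.
Proof.
move=> acu u0 t /andP[at_ tb]; apply/eqP; apply: contrapT => /negP ut.
have e0 : 0 < `|u t| by rewrite normr_gt0.
have [d d0 H] := real_ac_dist acu e0.
have tm : t < Num.min b (t + d) by rewrite lt_min tb ltrDl.
have [x /andP[tx xm] Px] := ae_meets tm u0.
move: xm; rewrite lt_min => /andP[xb xd].
have ux : u x = 0 by apply: Px; rewrite /= in_itv/= xb (le_lt_trans at_ tx).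
have := H t x at_ (ltW tx) (ltW xb); rewrite ux sub0r normrN ltxx.
by move=> h; suff: false by []; apply: h; lra.
Qed.

Lemma solves_bvpB m (A : R -> 'M[R]_m) al be F Y Z : mx_integrable A -> mx_integrable F ->
  solves_bvp a b A al be F 0 Y -> solves_bvp a b A al be F 0 Z ->
  solves_bvp a b A al be (fun=> 0) 0 (fun t => Y t - Z t).
Proof.
move=> hA hF [[y0 solY] bcY] [[z0 solZ] bcZ]; split.
  exists (y0 - z0); have := solvesB hA hF hF solY solZ.
  by under [X in solves A X]eq_fun do rewrite subrr.
by rewrite !mulmxBr addrACA -opprD bcY bcZ subrr.
Qed.

Lemma real_source0 : real_source a b (fun=> 0) = (fun=> 0).
Proof.
apply/funext => t; rewrite /real_source (_ : cut a b _ t = 0) ?rvec0//.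
rewrite /cut; case: ifP => // _; apply/matrixP => i j; rewrite !mxE oppr0.
by case: ifP.
Qed.

Lemma inLp2_0 : inLp a b 2 (fun=> 0 : R[i]).
Proof.
apply: (inLp2_of_bounded ab _ (lexx 0) _).1 => [|t _]; last by rewrite Normc.normc0.
by split; exact: measurable_cst.
Qed.

Lemma normLp2_0 : normLp a b 2 (fun=> 0 : R[i]) = 0%E.
Proof.
have [_] : inLp a b 2 (fun=> 0 : R[i]) /\
    (normLp a b 2 (fun=> 0%R : R[i]) <= (0 * Num.sqrt (b - a))%:E)%E.
  apply: (inLp2_of_bounded ab _ (lexx 0) _) => [|t _]; last by rewrite Normc.normc0.
  by split; exact: measurable_cst.
by rewrite mul0r => h; apply/eqP; rewrite eq_le h normLp_ge0.
Qed.

Lemma normLp2_ae_eq (f g : R -> R[i]) : inLp a b 2 f -> inLp a b 2 g ->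
  aeJ a b (fun t => f t = g t) -> normLp a b 2 f = normLp a b 2 g.
Proof.
move=> f2 g2 fg; rewrite !normLp2E//; congr ((Num.sqrt _)%:E).
have [mf hf] := (inLp2P a b f).1 f2; have [mg hg] := (inLp2P a b g).1 g2.
congr fine; apply: ae_eq_integral => //.
- exact: (measurable_int _ hf).
- exact: (measurable_int _ hg).
- apply: ae_imp fg => t fgt _ /=; congr (normc _ ^+ 2)%:E.
  have [tJ|tJ] := pselect (`]a, b[%classic t); last by rewrite !cut_out.
  by rewrite !cut_in// fgt.
Qed.

Section Nondegenerate.
Variables (p Q : R -> R[i]).
Hypotheses (Vp_L1 : inLp a b 1 (fun t => (p t)^-1))
  (Qp_L1 : inLp a b 1 (fun t => Q t / p t))
  (Q2p_L1 : inLp a b 1 (fun t => Q t ^+ 2 / p t))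
  (p_neq0 : aeJ a b (fun t => p t != 0)).

(** Uniqueness for the resolvent with [f = 0] gives [y = 0] almost everywhere, hence on [[a, b[] by
    continuity. The equation then forces [y1 = 0] there too, so the initial vector is 0, and so is
    the whole solution. *)
Lemma nondegenerate_of_resolvent al be mu :
  in_resolvent_set a b (sturm_liouville a b p Q al be) mu ->
  nondegenerate a b (real_system a b p Q mu) (rmx al) (rmx be).
Proof.
move=> [_ uniq _] Y solY; have hA := mx_integrable_real_system Vp_L1 Qp_L1 Q2p_L1 mu.
have sA := supported_real_system (a := a) (b := b) p Q mu.
have f2 := inLp2_0.
have sol0 : solves_bvp a b (real_system a b p Q mu) (rmx al) (rmx be)
    (real_source a b (fun=> 0)) 0 (fun=> 0).
  rewrite real_source0; split; last by rewrite !mulmx0 addr0.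
  exists 0; split; first exact: mx_bounded_measurable_cst.
  move=> t; rewrite add0r; apply/matrixP => i j; rewrite !mxE -[LHS](indef0 t).
  by congr (indef _ t); apply/funext => s; rewrite mulmx0 addr0 mxE.
have solY' : solves_bvp a b (real_system a b p Q mu) (rmx al) (rmx be)
    (real_source a b (fun=> 0)) 0 Y by rewrite real_source0.
have [_ r0] := resolvent_of_solves ab Vp_L1 Qp_L1 Q2p_L1 p_neq0 f2 sol0.
have [_ rY] := resolvent_of_solves ab Vp_L1 Qp_L1 Q2p_L1 p_neq0 f2 solY'.
have aey := uniq _ _ _ f2 rY r0.
have [[y0 sol] _] := solY'.
have acY := solves_real_ac a b hA (mx_integrable_real_source f2) sol.
have zero j : aeJ a b (fun t => cvec (Y t) j 0 = 0) ->
    forall t, a <= t < b -> cvec (Y t) j 0 = 0.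
  move=> ae0 t tab; rewrite mxE; congr (_ +i* _)%C.
    apply: (real_ac_ae0 (acY (lshift 2 j))) tab.
    by apply: ae_imp ae0 => s H /H; rewrite mxE => -[].
  apply: (real_ac_ae0 (acY (rshift 2 j))) tab.
  by apply: ae_imp ae0 => s H /H; rewrite mxE => -[].
have y_0 : forall t, a <= t < b -> cvec (Y t) 0 0 = 0.
  apply: zero; apply: ae_imp aey => t H /H ->.
  by rewrite mxE !mxE.
have y1_0 : forall t, a <= t < b -> cvec (Y t) 1 0 = 0.
  apply: zero; apply: ae_imp2 p_neq0 (solves_has_deriv Vp_L1 Qp_L1 Q2p_L1 f2 sol).
  move=> t pn H tJ; have p0 := pn tJ.
  have tab : a < t < b by move: tJ; rewrite /= in_itv.
  have [dr di] := H tJ 0.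
  (* [y] vanishes around [t], so its derivative, which is [(Q/p) y + (1/p) y1] at [t], is 0. As
     [y t = 0] and [p t != 0], this leaves [y1 t = 0]. *)
  have near0 : \near t, cvec (Y t) 0 0 = 0.
    have : \near t, t \in `]a, b[ by apply: near_in_itvoo; rewrite in_itv.
    by apply: filterS => s; rewrite in_itv /= => /andP[/ltW as_ sb]; apply: y_0; rewrite as_ sb.
  have dr0 : is_derive t (1 : R) (fun s : R => complex.Re (cvec (Y s) 0 0)) 0.
    apply: (near_eq_is_derive _ (is_derive_cst (0 : R) t 1)).
    by apply: filterS near0 => s ->.
  have di0 : is_derive t (1 : R) (fun s : R => complex.Im (cvec (Y s) 0 0)) 0.
    apply: (near_eq_is_derive _ (is_derive_cst (0 : R) t 1)).
    by apply: filterS near0 => s ->.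
  have /eqP : (system_mx p Q mu t *m cvec (Y t) + source (fun=> 0) t) 0 0 = 0.
    have e1 := @derive_val _ _ _ _ _ _ _ dr; have e2 := @derive_val _ _ _ _ _ _ _ di.
    move: e1 e2; rewrite (@derive_val _ _ _ _ _ _ _ dr0) (@derive_val _ _ _ _ _ _ _ di0).
    by case: (_ 0 0) => u v /= <- <-.
  have tab' : a <= t < b by case/andP: tab => /ltW-> ->.
  rewrite cvec_boundary_vector system_entry eqxx y_0// mulr0 add0r mulf_eq0 invr_eq0.
  by rewrite (negbTE p0) -cvec_boundary_vector => /eqP.
have Ya : Y a = 0.
  rewrite -[Y a]rvecK (_ : cvec (Y a) = 0) ?rvec0//.
  apply/matrixP => i j; rewrite (ord1 j) [RHS]mxE.
  have aab : a <= a < b by rewrite lexx.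
  have [->|->] : i = 0 \/ i = 1.
    by case: i => -[|[|//]] hi; [left|right]; exact: val_inj.
  - exact: y_0.
  - exact: y1_0.
have [[z0 solz] _] := solY.
have s0 : supported a b (fun=> 0 : 'cV[R]_(2 + 2)) by [].
have zE := solves_left sA s0 solz.
by move: solz; rewrite -zE Ya; exact: (solves_eq0 ab hA sA).
Qed.

End Nondegenerate.
End Perturbation.

(** * Comparison of the resolvents of two operators *)

Section ResolventComparison.
Context {R : realType} (a b : R) (ab : a < b).
Local Notation normc := (@Normc.normc R).
Local Notation lebesgue := (@lebesgue_measure R).

(** The spectral parameter cancels in the difference. The entry [Q/p] occurs twice in the system,
    whence the 2, and passing to the real matrix costs the 4. *)
Lemma real_system_distance (p0 Q0 p1 Q1 : R -> R[i]) mu :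
  inLp a b 1 (fun t => (p0 t)^-1) -> inLp a b 1 (fun t => Q0 t / p0 t) ->
  inLp a b 1 (fun t => Q0 t ^+ 2 / p0 t) ->
  inLp a b 1 (fun t => (p1 t)^-1) -> inLp a b 1 (fun t => Q1 t / p1 t) ->
  inLp a b 1 (fun t => Q1 t ^+ 2 / p1 t) ->
  mx_total (fun t => real_system a b p1 Q1 mu t - real_system a b p0 Q0 mu t) <=
  4 * (fine (normLp a b 1 (fun t => (p1 t)^-1 - (p0 t)^-1)) +
    2 * fine (normLp a b 1 (fun t => Q1 t / p1 t - Q0 t / p0 t)) +
    fine (normLp a b 1 (fun t => Q1 t ^+ 2 / p1 t - Q0 t ^+ 2 / p0 t))).
Proof.
move=> V0 Q0p Q20 V1 Q1p Q21.
have dV := inLp1B V1 V0; have dQ := inLp1B Q1p Q0p; have dS := inLp1B Q21 Q20.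
rewrite !normLp1E//=.
set fV := (fun t => (p1 t)^-1 - (p0 t)^-1) in dV *.
set fQ := (fun t => Q1 t / p1 t - Q0 t / p0 t) in dQ *.
set fS := (fun t => Q1 t ^+ 2 / p1 t - Q0 t ^+ 2 / p0 t) in dS *.
have iV := real_integrable_norm (inLp1_integrable dV).
have iQ := real_integrable_norm (inLp1_integrable dQ).
have iS := real_integrable_norm (inLp1_integrable dS).
have iQ2 := real_integrableZ 2 iQ; have iVQ := real_integrableD iV iQ2.
have iVQS := real_integrableD iVQ iS.
rewrite /mx_total /total_norm -[X in _ + X + _]RintegralZl// -RintegralD// -RintegralD//.
rewrite -RintegralZl//; apply: le_Rintegral => //.
- apply: real_integrable_norm; apply: mx_integrable_norm; apply: mx_integrableB;
    exact: mx_integrable_real_system.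
- exact: real_integrableZ.
- move=> t _; rewrite !ger0_norm ?mnorm_ge0 ?normc_ge0// /real_system -rmxB.
  apply: (le_trans (mnorm_rmx _)); apply: ler_wpM2l => //.
  rewrite /fV /fQ /fS /cut; case: ifP => _; last first.
    by rewrite subrr Normc.normc0 /cmnorm !big1 ?mulr0 ?addr0// => i _; rewrite big1// => j _;
      rewrite mxE Normc.normc0.
  rewrite /cmnorm !big_ord_recl !big_ord0 !mxE /=.
  have e1 : - (Q1 t / p1 t) - - (Q0 t / p0 t) = - (Q1 t / p1 t - Q0 t / p0 t) by ring.
  have e2 : - (Q1 t ^+ 2 / p1 t) - mu - (- (Q0 t ^+ 2 / p0 t) - mu) =
    - (Q1 t ^+ 2 / p1 t - Q0 t ^+ 2 / p0 t) by ring.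
  by rewrite e1 e2 !normcN !addr0; lra.
Qed.

Lemma resolvent_domain p Q (al be : 'M[R[i]]_2) mu f y :
  resolvent a b (sturm_liouville a b p Q al be) mu f y -> inLp a b 2 y.
Proof. by move=> [g [y1 [y2 [[]]]]]. Qed.

(** The length [b - a] is the product of two factors [Num.sqrt (b - a)]: one from the sup norm to
    L_2 for [y], one from L_2 to L_1 for [f]. *)
Lemma normLp2_le_solution (Y : R -> 'cV[R]_(2 + 2)) (y f : R -> R[i]) (C : R) :
  inLp a b 2 y -> inLp a b 2 f -> 0 <= C ->
  (forall t, `]a, b[%classic t -> cvec (Y t) 0 0 = y t) ->
  (forall t, mnorm (Y t) <= C * total_norm (fun t => normc (cut a b f t))) ->
  (normLp a b 2 y <= (C * (b - a))%:E * normLp a b 2 f)%E.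
Proof.
move=> y2 f2 C0 Yy YC.
have T0 := total_norm_ge0 (fun t => normc (cut a b f t)).
have [|_] := inLp2_of_bounded ab y2.1 (mulr_ge0 C0 T0).
  by move=> t tJ; rewrite -Yy//; exact: le_trans (normc_cvec _ _) (YC t).
move=> /le_trans; apply; have := total_norm_le_normLp2 ab f2.
rewrite normLp2E// -!EFinM !lee_fin => h.
have S0 := sqrtr_ge0 (b - a).
have e : b - a = Num.sqrt (b - a) * Num.sqrt (b - a).
  by rewrite -expr2 sqr_sqrtr// subr_ge0 ltW.
rewrite [in X in _ <= X]e; set N := Num.sqrt (Rintegral _ _ _) in h *.
have := ler_wpM2l (mulr_ge0 C0 S0) h; lra.
Qed.

Lemma resolvent_comparison (p0 Q0 : R -> R[i]) (al0 be0 : 'M[R[i]]_2) mu :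
  inLp a b 1 (fun t => (p0 t)^-1) -> inLp a b 1 (fun t => Q0 t / p0 t) ->
  inLp a b 1 (fun t => Q0 t ^+ 2 / p0 t) -> aeJ a b (fun t => p0 t != 0) ->
  in_resolvent_set a b (sturm_liouville a b p0 Q0 al0 be0) mu ->
  exists2 C : R, 0 < C & forall (p1 Q1 : R -> R[i]) (al1 be1 : 'M[R[i]]_2) (d : R),
    inLp a b 1 (fun t => (p1 t)^-1) -> inLp a b 1 (fun t => Q1 t / p1 t) ->
    inLp a b 1 (fun t => Q1 t ^+ 2 / p1 t) -> aeJ a b (fun t => p1 t != 0) ->
    fine (normLp a b 1 (fun t => (p1 t)^-1 - (p0 t)^-1)) +
    fine (normLp a b 1 (fun t => Q1 t / p1 t - Q0 t / p0 t)) +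
    fine (normLp a b 1 (fun t => Q1 t ^+ 2 / p1 t - Q0 t ^+ 2 / p0 t)) +
    cmnorm (al1 - al0) + cmnorm (be1 - be0) <= d -> C * d <= 1 ->
    in_resolvent_set a b (sturm_liouville a b p1 Q1 al1 be1) mu /\
    (0 <= opnorm a b (sub_operator a b (resolvent a b (sturm_liouville a b p1 Q1 al1 be1) mu)
      (resolvent a b (sturm_liouville a b p0 Q0 al0 be0) mu)) <= (C * d)%:E)%E.
Proof.
move=> V0 Q0p Q20 p0n rho; have nd := nondegenerate_of_resolvent ab V0 Q0p Q20 p0n rho.
have hA0 := mx_integrable_real_system V0 Q0p Q20 mu.
have sA0 := supported_real_system (a := a) (b := b) p0 Q0 mu.
have [K K0 HK] := nondegenerate_perturbation ab hA0 sA0 nd.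
have L0 : 0 < b - a by rewrite subr_gt0.
(* The first term makes [C * d <= 1] imply [K * (8 * d) <= 2^-1]. The second is the norm bound:
   [2 * K ^+ 2] for the difference of solutions, 8 for the real system, 2 for the real source, and
   [b - a] for the norms. *)
exists (16 * K + 32 * K ^+ 2 * (b - a)).
  by rewrite addr_gt0 ?mulr_gt0// exprn_gt0.
move=> p1 Q1 al1 be1 d V1 Q1p Q21 p1n dE Cd.
have hA1 := mx_integrable_real_system V1 Q1p Q21 mu.
have sA1 := supported_real_system (a := a) (b := b) p1 Q1 mu.
have n0 f : 0 <= fine (normLp a b 1 f) by apply: fine_ge0; exact: normLp_ge0.
have c0 (M : 'M[R[i]]_2) : 0 <= cmnorm M.
  by apply: sumr_ge0 => i _; apply: sumr_ge0 => j _; exact: normc_ge0.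
have d0 : 0 <= d by apply: le_trans dE; rewrite !addr_ge0.
have e1 : K * (8 * d) <= 2^-1.
  have : 0 <= 32 * K ^+ 2 * (b - a) * d by rewrite !mulr_ge0// ?sqr_ge0// ltW.
  move: Cd; rewrite mulrDl; lra.
(* The 8 is 4 times 2, for the entry [Q/p] that counts double; the other contributions need only
   4. *)
have e2 : mx_total (fun t => real_system a b p1 Q1 mu t - real_system a b p0 Q0 mu t) +
    mnorm (rmx al1 - rmx al0) + mnorm (rmx be1 - rmx be0) <= 8 * d.
  have h1 := real_system_distance mu V0 Q0p Q20 V1 Q1p Q21.
  have h2 := mnorm_rmx (al1 - al0); have h3 := mnorm_rmx (be1 - be0).
  rewrite -!rmxB; move: dE h1 h2 h3 (c0 (al1 - al0)) (c0 (be1 - be0)).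
  move: (n0 (fun t => (p1 t)^-1 - (p0 t)^-1)) (n0 (fun t => Q1 t / p1 t - Q0 t / p0 t))
    (n0 (fun t => Q1 t ^+ 2 / p1 t - Q0 t ^+ 2 / p0 t)).
  move: (fine _) (fine _) (fine _) (cmnorm _) (cmnorm _) (mx_total _) (mnorm _) (mnorm _).
  move=> *; lra.
have [nd1 HK1] := HK _ _ _ _ hA1 sA1 e1 e2.
have exist1 f : inLp a b 2 f ->
    exists y, resolvent a b (sturm_liouville a b p1 Q1 al1 be1) mu f y.
  move=> f2; have hF := mx_integrable_real_source f2.
  have [Y solY] := bvp_exists ab hA1 sA1 nd1 hF (supported_real_source (a := a) (b := b) f).
  by have [_ rY] := resolvent_of_solves ab V1 Q1p Q21 p1n f2 solY; exists (fun t => cvec (Y t) 0 0).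
have rho1 : in_resolvent_set a b (sturm_liouville a b p1 Q1 al1 be1) mu.
  split=> [//|f y z f2 ry rz|].
    have [Y [solY Yy]] := solves_of_resolvent ab V1 Q1p Q21 p1n f2 ry.
    have [Z [solZ Zz]] := solves_of_resolvent ab V1 Q1p Q21 p1n f2 rz.
    have YZ := nd1 _ (solves_bvpB hA1 (mx_integrable_real_source f2) solY solZ).
    apply: aeW => t tJ; rewrite -Yy// -Zz//; congr (cvec _ _ _).
    by apply/eqP; rewrite -subr_eq0; apply/eqP.
  (* The solution bound [2 * K], the factor 2 of the real source, and [b - a] for the norms. *)
  exists (4 * K * (b - a)) => f y f2 ry.
  have [Y [solY Yy]] := solves_of_resolvent ab V1 Q1p Q21 p1n f2 ry.
  have [bY _] := HK1 _ _ (mx_integrable_real_source f2)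
    (supported_real_source (a := a) (b := b) f) solY.
  apply: (normLp2_le_solution (resolvent_domain ry) f2 _ Yy).
    by rewrite mulr_ge0// ltW.
  move=> t; apply: (le_trans (bY t)).
  have := ler_wpM2l (mulr_ge0 (ler0n R 2) (ltW K0)) (mx_total_real_source f2); lra.
split=> //; apply/andP; split.
  (* The supremum of an empty set would be -oo, so the lower bound 0 needs a member of the set;
     [f = 0] provides one. *)
  have f2 := inLp2_0 ab; have [g rg] := exist1 _ f2.
  have [h rh] : exists h, resolvent a b (sturm_liouville a b p0 Q0 al0 be0) mu (fun=> 0) h.
    by case: rho => ex _ _; exact: ex.
  apply: le_trans (normLp_ge0 a b 2 (fun t => g t - h t)) _.
  apply: ereal_sup_ubound; exists (fun=> 0), (fun t => g t - h t); split => //.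
  - by rewrite normLp2_0.
  - have := inLp2D (resolvent_domain rg) (inLp2Z (-1) (resolvent_domain rh)).
    by under [X in inLp _ _ _ X]eq_fun do rewrite mulN1r.
  - by exists g, h; split => //; apply: aeW.
apply: ge_ereal_sup => _ [f [z [f2 f1 z2 [g [h [rg rh zE]]] ->]]].
have [Y1 [sol1 Yg]] := solves_of_resolvent ab V1 Q1p Q21 p1n f2 rg.
have [Y0 [sol0 Yh]] := solves_of_resolvent ab V0 Q0p Q20 p0n f2 rh.
have [_ /(_ _ sol0) bY] := HK1 _ _ (mx_integrable_real_source f2)
  (supported_real_source (a := a) (b := b) f) sol1.
have gh2 : inLp a b 2 (fun t => g t - h t).
  have := inLp2D (resolvent_domain rg) (inLp2Z (-1) (resolvent_domain rh)).
  by under [X in inLp _ _ _ X]eq_fun do rewrite mulN1r.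
rewrite (normLp2_ae_eq z2 gh2 zE).
have Kd0 : 0 <= 32 * K ^+ 2 * d by rewrite !mulr_ge0// ?exprn_ge0// ltW.
apply: (@le_trans _ _ ((32 * K ^+ 2 * d * (b - a))%:E * normLp a b 2 f)%E).
  apply: (@normLp2_le_solution (fun t => Y1 t - Y0 t)) => //.
    move=> t tJ; rewrite -Yg// -Yh// !mxE.
    by apply/eqP; rewrite eq_complex /= !eqxx.
  move=> t; apply: (le_trans (bY t)).
  have Kd1 : 0 <= 2 * K ^+ 2 * (8 * d) by rewrite !mulr_ge0// ?exprn_ge0// ltW.
  have := ler_wpM2l Kd1 (mx_total_real_source f2); lra.
apply: (@le_trans _ _ ((32 * K ^+ 2 * d * (b - a))%:E * 1)%E).
  by apply: lee_wpmul2l => //; rewrite lee_fin mulr_ge0// ltW.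
rewrite mule1 lee_fin; have : 0 <= 16 * K * d by rewrite !mulr_ge0// ltW.
lra.
Qed.

End ResolventComparison.

(** * Norm resolvent convergence *)

Theorem theorem2 (R : realType) (a b eps0 : R)
    (p Q : R -> R -> R[i]) (alpha beta : R -> 'M[R[i]]_2)
    (ltab : a < b) (eps0_gt0 : 0 < eps0)
    (p_meas : forall eps : R, 0 <= eps <= eps0 -> measurableJ a b (p eps))
    (Q_meas : forall eps : R, 0 <= eps <= eps0 -> measurableJ a b (Q eps))
    (p_neq0 : forall eps : R, 0 <= eps <= eps0 -> aeJ a b (fun t => p eps t != 0))
    (Vp_L1 : forall eps : R, 0 <= eps <= eps0 ->
      inLp a b 1 (fun t => (p eps t)^-1))
    (Qp_L1 : forall eps : R, 0 <= eps <= eps0 ->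
      inLp a b 1 (fun t => Q eps t / p eps t))
    (Q2p_L1 : forall eps : R, 0 <= eps <= eps0 ->
      inLp a b 1 (fun t => Q eps t ^+ 2 / p eps t))
    (rho_neq0 : exists mu, in_resolvent_set a b
      (sturm_liouville a b (p 0) (Q 0) (alpha 0) (beta 0)) mu)
    (cvg_Vp : normLp a b 1 (fun t => (p eps t)^-1 - (p 0 t)^-1)
      @[eps --> 0^'+] --> 0%E)
    (cvg_Qp : normLp a b 1 (fun t => Q eps t / p eps t - Q 0 t / p 0 t)
      @[eps --> 0^'+] --> 0%E)
    (cvg_Q2p : normLp a b 1
        (fun t => Q eps t ^+ 2 / p eps t - Q 0 t ^+ 2 / p 0 t)
      @[eps --> 0^'+] --> 0%E)
    (cvg_alpha : forall i j,
      Normc.normc (alpha eps i j - alpha 0 i j) @[eps --> 0^'+] --> (0 : R))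
    (cvg_beta : forall i j,
      Normc.normc (beta eps i j - beta 0 i j) @[eps --> 0^'+] --> (0 : R)) :
  norm_resolvent_cvg a b
    (fun eps => sturm_liouville a b (p eps) (Q eps) (alpha eps) (beta eps)).
Proof.
have [mu rho] := rho_neq0; exists mu.
have e0_range : 0 <= (0 : R) <= eps0 by rewrite lexx ltW.
have [C C0 HC] := resolvent_comparison ltab (Vp_L1 0 e0_range) (Qp_L1 0 e0_range)
  (Q2p_L1 0 e0_range) (p_neq0 0 e0_range) rho.
have cmnorm_cvg (M : R -> 'M[R[i]]_2) :
    (forall i j, Normc.normc (M eps i j - M 0 i j) @[eps --> 0^'+] --> (0 : R)) ->
    cmnorm (M eps - M 0) @[eps --> 0^'+] --> (0 : R).
  move=> cvgM; rewrite /cmnorm.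
  have cvg4 : \sum_(i < 2) \sum_(j < 2) Normc.normc (M eps i j - M 0 i j)
      @[eps --> 0^'+] --> \sum_(i < 2) \sum_(j < 2) (0 : R).
    by rewrite !big_ord_recl !big_ord0; under eq_fun do rewrite !big_ord_recl !big_ord0;
      apply: cvgD; [|apply: cvgD; [|exact: cvg_cst]];
      (apply: cvgD; [exact: cvgM|apply: cvgD; [exact: cvgM|exact: cvg_cst]]).
  have sum0 : \sum_(i < 2) \sum_(j < 2) (0 : R) = 0 by apply: big1 => i _; exact: big1.
  move: cvg4; rewrite sum0.
  apply: cvg_trans; apply: near_eq_cvg; near=> eps.
  by apply: eq_bigr => i _; apply: eq_bigr => j _; rewrite !mxE.
(* The distance between the two problems itself serves as the [d] of [resolvent_comparison]; by
   (1)-(4) it tends to 0, so [C * D eps <= 1] for small [eps]. *)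
pose D eps := fine (normLp a b 1 (fun t => (p eps t)^-1 - (p 0 t)^-1)) +
  fine (normLp a b 1 (fun t => Q eps t / p eps t - Q 0 t / p 0 t)) +
  fine (normLp a b 1 (fun t => Q eps t ^+ 2 / p eps t - Q 0 t ^+ 2 / p 0 t)) +
  cmnorm (alpha eps - alpha 0) + cmnorm (beta eps - beta 0).
have D_cvg : C * D eps @[eps --> 0^'+] --> (0 : R).
  have cvgD0 : D eps @[eps --> 0^'+] --> (0 + 0 + 0 + 0 + 0 : R).
    exact: (cvgD (cvgD (cvgD (cvgD (fine_cvg cvg_Vp) (fine_cvg cvg_Qp)) (fine_cvg cvg_Q2p))
      (cmnorm_cvg alpha cvg_alpha)) (cmnorm_cvg beta cvg_beta)).
  move: cvgD0; rewrite !addr0 => cvgD0.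
  have : C * D eps @[eps --> 0^'+] --> C * 0 by apply: cvgM => //; exact: cvg_cst.
  by rewrite mulr0.
have comparison : \forall eps \near 0^'+,
    in_resolvent_set a b
      (sturm_liouville a b (p eps) (Q eps) (alpha eps) (beta eps)) mu /\
    (0 <= opnorm a b (sub_operator a b
       (resolvent a b (sturm_liouville a b (p eps) (Q eps) (alpha eps) (beta eps)) mu)
       (resolvent a b (sturm_liouville a b (p 0%R) (Q 0%R) (alpha 0%R) (beta 0%R)) mu))
     <= (C * D eps)%:E)%E.
  have CD1 : \forall eps \near 0^'+, C * D eps <= 1.
    have := D_cvg => /cvgrPdist_le /(_ 1 ltr01); apply: filterS => eps.
    by rewrite sub0r normrN; apply: le_trans; exact: ler_norm.
  near=> eps.
  have range : 0 <= eps <= eps0.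
    by apply/andP; split; [apply: ltW|]; near: eps; [exact: nbhs_right_gt|exact: nbhs_right_le].
  apply: HC; [exact: Vp_L1|exact: Qp_L1|exact: Q2p_L1|exact: p_neq0|exact: lexx|].
  by near: eps.
split=> //.
  by apply: filterS comparison => eps [].
(* For small [eps] the operator norm lies between 0 and [C * D eps]. *)
apply: (@squeeze_cvge _ _ _ _ (fun=> 0%E) _ (fun eps => (C * D eps)%:E)).
- by apply: filterS comparison => eps [].
- exact: cvg_cst.
- by apply: cvg_EFin => //; near=> eps.
Unshelve. all: by end_near. Qed.
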